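(* For all $T>0$, for all $S>0$, for any $\gamma>0$, for all $\Delta s>0$ (of the form $\Delta s=S/n$), and for any positive $\Delta t<2$ satisfying $$g\left(\Delta t,\tfrac{2}{\Delta s},\gamma\right)>0,$$ there exist positive constants $C_1,C_2$ (depending on $\gamma$ and $S$) such that, with $m=\lfloor T/\Delta t\rfloor$, $$\|(\boldsymbol{O}\boldsymbol{C}\boldsymbol{O})^m-\boldsymbol{\Phi}(m\Delta t)\|\le \exp(C_1T)\,\Delta t^2\,\Delta s^{-5},$$ $$\|\boldsymbol{\Gamma}^m-\boldsymbol{\Gamma}(m\Delta t)\|\le\exp(C_2T)\,\Delta t^2\,\Delta s^{-4}.$$
   Context: Let $S>0$, let $n\ge2$ be an integer and let $\Delta s = S/n$ (spatial step size); $\Delta t>0$ is the time step size and $\gamma$ a friction parameter. $\boldsymbol{L}$ is the $(n-1)\times(n-1)$ discrete Dirichlet Laplacian: the symmetric tridiagonal matrix with diagonal entries $-2/\Delta s^2$ and entries $1/\Delta s^2$ on the first sub- and superdiagonal; $\boldsymbol{I}$ is the identity matrix; $\|\cdot\|$ is the Frobenius norm. Exact dynamics: the linear Langevin SDE $d\boldsymbol{u}=\boldsymbol{p}\,dt$, $d\boldsymbol{p}=\boldsymbol{L}\boldsymbol{u}\,dt-\boldsymbol{u}\,dt-\gamma\boldsymbol{p}\,dt+\sqrt{2\gamma/\Delta s}\,d\boldsymbol{W}$ on $\mathbb{R}^{2(n-1)}$, $\boldsymbol{W}$ an $(n-1)$-dimensional Wiener process. For a deterministic initial condition its solution at time $t$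 is Gaussian with mean $\boldsymbol{\Phi}(t)\begin{bmatrix}\boldsymbol{u}(0)\\ \boldsymbol{p}(0)\end{bmatrix}$ and covariance matrix $\boldsymbol{\Gamma}(t)$, where $$\boldsymbol{\Phi}(t)=\exp(t\boldsymbol{K}),\qquad \boldsymbol{K}=\begin{bmatrix}\boldsymbol{0}&\boldsymbol{I}\\ \boldsymbol{L}-\boldsymbol{I}&-\gamma\boldsymbol{I}\end{bmatrix},$$ and $\boldsymbol{\Gamma}(t)$ solves the Lyapunov equation $$\boldsymbol{K}\boldsymbol{\Gamma}(t)+\boldsymbol{\Gamma}(t)\boldsymbol{K}^{\mathrm T}=\frac{2\gamma}{\Delta s}\left(\boldsymbol{\Phi}(t)\begin{bmatrix}\boldsymbol{0}&\boldsymbol{0}\\ \boldsymbol{0}&\boldsymbol{I}\end{bmatrix}\boldsymbol{\Phi}(t)^{\mathrm T}-\begin{bmatrix}\boldsymbol{0}&\boldsymbol{0}\\ \boldsymbol{0}&\boldsymbol{I}\end{bmatrix}\right).$$ Numerical method (Cayley splitting): let $$\boldsymbol{A} = \begin{bmatrix} \boldsymbol{0} & \boldsymbol{I}\\ \boldsymbol{L} & \boldsymbol{0}\end{bmatrix},\quad \boldsymbol{B}=\begin{bmatrix}\boldsymbol{0}&\boldsymbol{0}\\-\boldsymbol{I}&\boldsymbol{0}\end{bmatrix},\quad \boldsymbol{C} = \exp\left(\tfrac12 \Delta t\, \boldsymbol{B}\right)\mathrm{cay}(\Delta t\, \boldsymbol{A})\exp\left(\tfrac12 \Delta t\, \boldsymbol{B}\right),\quad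 \boldsymbol{O}=\begin{bmatrix}\boldsymbol{I}&\boldsymbol{0}\\ \boldsymbol{0}& e^{-\gamma\Delta t/2}\boldsymbol{I}\end{bmatrix},$$ where $\mathrm{cay}(\boldsymbol{X})=(\boldsymbol{I}-\frac12\boldsymbol{X})^{-1}(\boldsymbol{I}+\frac12\boldsymbol{X})$. One step $(\boldsymbol{u}^0,\boldsymbol{p}^0)\mapsto(\boldsymbol{u}^1,\boldsymbol{p}^1)$ is: (1) $\boldsymbol{p}^{1/3}=e^{-\gamma\Delta t/2}\boldsymbol{p}^0+\sqrt{1/\Delta s}\,\sqrt{1-e^{-\gamma\Delta t}}\,\boldsymbol{\xi}^0$; (2) $\begin{bmatrix}\boldsymbol{u}^1\\ \boldsymbol{p}^{2/3}\end{bmatrix}=\boldsymbol{C}\begin{bmatrix}\boldsymbol{u}^0\\ \boldsymbol{p}^{1/3}\end{bmatrix}$; (3) $\boldsymbol{p}^1=e^{-\gamma\Delta t/2}\boldsymbol{p}^{2/3}+\sqrt{1/\Delta s}\,\sqrt{1-e^{-\gamma\Delta t}}\,\boldsymbol{\eta}^0$, where $\boldsymbol{\xi}^0,\boldsymbol{\eta}^0$ are independent standard normal vectors in $\mathbb{R}^{n-1}$, drawn independently at each step. For a deterministic initial condition, the output after $m$ steps is Gaussian with mean $(\boldsymbol{O}\boldsymbol{C}\boldsymbol{O})^m\begin{bmatrix}\boldsymbol{u}^0\\ \boldsymbol{p}^0\end{bmatrix}$, and $\boldsymbol{\Gamma}^m$ denotes its covariance matrix. For $0<\Delta t<2$, $\omega>0$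 and $\gamma\ge0$, $$g(\Delta t,\omega,\gamma)=1-\cos^2(\theta)\cosh^2\left(\frac{\gamma\Delta t}{2}\right),\qquad \theta=2\arctan\left(\frac{\Delta t}{\sqrt{4-\Delta t^2}}\sqrt{1+\omega^2}\right).$$ *)

(* Defs.v *)
From HB Require Import structures.
From mathcomp Require Import all_boot all_order all_algebra.
From mathcomp Require Import all_classical all_reals all_analysis.
Set Implicit Arguments.
Unset Strict Implicit.
Unset Printing Implicit Defensive.
Import Order.TTheory GRing.Theory Num.Theory.
Import numFieldNormedType.Exports.
Local Open Scope classical_set_scope.
Local Open Scope ring_scope.

Definition frobenius {R : realType} {p q : nat} (A : 'M[R]_(p, q)) : R :=
  Num.sqrt (\sum_(i < p) \sum_(j < q) A i j ^+ 2).

(* The limit is taken entrywise; the series converges for every A. *)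
Definition expmx {R : realType} {p : nat} (A : 'M[R]_p) : 'M[R]_p :=
  \matrix_(i, j)
    limn (series (fun k : nat => (A ^+ k) i j / (k`!)%:R : R)).

Definition cay {R : realType} {p : nat} (X : 'M[R]_p) : 'M[R]_p :=
  invmx (1%:M - 2^-1 *: X) *m (1%:M + 2^-1 *: X).

Definition cosh {R : realType} (x : R) : R := (expR x + expR (- x)) / 2.

Definition theta {R : realType} (dt omega : R) : R :=
  2 * atan (dt / Num.sqrt (4 - dt ^+ 2) * Num.sqrt (1 + omega ^+ 2)).

Definition g {R : realType} (dt omega gamma : R) : R :=
  1 - cos (theta dt omega) ^+ 2 * cosh (gamma * dt / 2) ^+ 2.

(* In what follows d is the number of interior grid points, i.e. n - 1, and a
   phase-space point (u, p) is a column vector of height d + d. *)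

Definition laplacian {R : realType} (d : nat) (ds : R) : 'M[R]_d :=
  \matrix_(i, j)
    (if i == j then - 2 / ds ^+ 2
     else if (i.+1 == j :> nat) || (j.+1 == i :> nat) then 1 / ds ^+ 2
     else 0).

Definition Kmx {R : realType} (d : nat) (ds gamma : R) : 'M[R]_(d + d) :=
  block_mx 0 1%:M (laplacian d ds - 1%:M) (- gamma%:M).

Definition Phi {R : realType} (d : nat) (ds gamma t : R) : 'M[R]_(d + d) :=
  expmx (t *: Kmx d ds gamma).

Definition Pmx {R : realType} (d : nat) : 'M[R]_(d + d) :=
  block_mx 0 0 0 1%:M.

(* Lyapunov equation for the covariance G = Gamma(t) of the Langevin SDE.  For
   gamma > 0 all eigenvalues of Kmx have negative real part, so the equation
   has exactly one solution G. *)
Definition is_exact_covariance {R : realType} (d : nat) (ds gamma t : R)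
    (G : 'M[R]_(d + d)) : Prop :=
  let K := Kmx d ds gamma in
  let F := Phi d ds gamma t in
  K *m G + G *m K^T = (2 * gamma / ds) *: (F *m Pmx d *m F^T - Pmx d).

Definition Amx {R : realType} (d : nat) (ds : R) : 'M[R]_(d + d) :=
  block_mx 0 1%:M (laplacian d ds) 0.

Definition Bmx {R : realType} (d : nat) : 'M[R]_(d + d) :=
  block_mx 0 0 (- 1%:M) 0.

Definition Cmx {R : realType} (d : nat) (ds dt : R) : 'M[R]_(d + d) :=
  expmx ((2^-1 * dt) *: Bmx d) *m cay (dt *: Amx d ds)
    *m expmx ((2^-1 * dt) *: Bmx d).

Definition Omx {R : realType} (d : nat) (gamma dt : R) : 'M[R]_(d + d) :=
  block_mx 1%:M 0 0 (expR (- (gamma * dt / 2)))%:M.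

Definition ou_half_step {R : realType} (d : nat) (ds gamma dt : R)
    (z : 'cV[R]_(d + d)) (x : 'cV[R]_d) : 'cV[R]_(d + d) :=
  col_mx (usubmx z)
    (expR (- (gamma * dt / 2)) *: dsubmx z
     + (Num.sqrt (1 / ds) * Num.sqrt (1 - expR (- (gamma * dt)))) *: x).

Definition cayley_step {R : realType} (d : nat) (ds gamma dt : R)
    (z : 'cV[R]_(d + d)) (xi eta : 'cV[R]_d) : 'cV[R]_(d + d) :=
  ou_half_step ds gamma dt
    (Cmx d ds dt *m ou_half_step ds gamma dt z xi) eta.

Fixpoint cayley_iter {R : realType} (d : nat) (ds gamma dt : R)
    (z0 : 'cV[R]_(d + d)) (xi eta : nat -> 'cV[R]_d) (m : nat)
    : 'cV[R]_(d + d) :=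
  if m is k.+1 then
    cayley_step ds gamma dt (cayley_iter ds gamma dt z0 xi eta k)
      (xi k) (eta k)
  else z0.

Definition mutually_independent {disp : measure_display}
    {T : measurableType disp} {R : realType} (P : probability T R)
    (I : eqType) (X : I -> {RV P >-> R}) : Prop :=
  forall (s : seq I) (A : I -> set R), uniq s ->
    (forall i, measurable (A i)) ->
    P (\bigcap_(i in [set` s]) (X i @^-1` A i)) =
    (\prod_(i <- s) P (X i @^-1` A i))%E.

(* xi k i and eta k i are the i-th coordinates of the noise vectors xi^k and
   eta^k of step k; inl and inr index the two families jointly. *)
Definition standard_normal_noise {disp : measure_display}
    {T : measurableType disp} {R : realType} (P : probability T R) (d : nat)
    (xi eta : nat -> 'I_d -> {RV P >-> R}) : Prop :=
  let Z (a : (nat * 'I_d) + (nat * 'I_d)) : {RV P >-> R} :=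
    match a with
    | inl ki => xi ki.1 ki.2
    | inr ki => eta ki.1 ki.2
    end in
  mutually_independent Z /\
  (forall a (A : set R), measurable A ->
    distribution P (Z a) A = normal_prob (0 : R) (1 : R) A).

Definition cayley_process {disp : measure_display}
    {T : measurableType disp} {R : realType} (P : probability T R) (d : nat)
    (ds gamma dt : R) (z0 : 'cV[R]_(d + d))
    (xi eta : nat -> 'I_d -> {RV P >-> R}) (m : nat) (w : T)
    : 'cV[R]_(d + d) :=
  cayley_iter ds gamma dt z0 (fun k => \col_i xi k i w)
    (fun k => \col_i eta k i w) m.

(* fine is harmless on square-integrable X, where the covariances are
   finite. *)
Definition covariance_mx {disp : measure_display}
    {T : measurableType disp} {R : realType} (P : probability T R) (p : nat)
    (X : T -> 'cV[R]_p) : 'M[R]_p :=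
  \matrix_(i, j)
    fine (covariance P (fun w => X w i 0) (fun w => X w j 0)).

(* Main.v *)
Require Import Defs.
From HB Require Import structures.
From mathcomp Require Import all_boot all_order all_algebra.
From mathcomp Require Import all_classical all_reals all_analysis.
From mathcomp Require Import measurable_realfun ring lra.
Set Implicit Arguments.
Unset Strict Implicit.
Unset Printing Implicit Defensive.
Import Order.TTheory GRing.Theory Num.Theory.
Import numFieldNormedType.Exports.
Local Open Scope classical_set_scope.
Local Open Scope ring_scope.

(** The discrete Laplacian is diagonal in an orthonormal basis of sine vectors
    ([laplacian_diag]), so every block matrix of the statement splits into one
    2 x 2 matrix per mode.  Let [-w] be the eigenvalue of a mode and put
    [l = sqrt (1 + w)].  Once the position is measured in units of [1 / l], the
    exact dynamics is the damped oscillator [osc_mx gamma l] and one step of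
    the scheme is [step_mx gamma dt l].  In these variables both stay bounded
    for all times and all modes: the flow decreases [x^2 + y^2]
    ([osc_flow_bounded]), and the step decreases [defect dt * x^2 + y^2], where
    [defect dt = 1 - dt^2 / 4] ([step_contract]).  The condition [0 < g] serves
    to bound [defect dt] from below by a constant that depends on [gamma]
    alone ([defect_ge]): as [dt] tends to 2 the cosine in [g] tends to -1, and
    the hyperbolic cosine then makes [g] negative.

    The propagators.  Matching Taylor expansions up to the second order give a
    local error of order [(dt * l)^3] ([step_error]); over [m] steps the errors
    add up to [T * dt^2 * l^3], because all powers are bounded
    ([mode_propagator_error]).  Undoing the rescaling costs another factor
    [l].  Since [l^2 <= 1 + 4 / ds^2] and there are fewer than [S / ds] modes,
    the total is of order [T * dt^2 * ds^-5] ([propagator_error]).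

    The covariances.  For the exact dynamics as well as for the scheme, the
    covariance is the stationary covariance minus its image under the
    propagator ([exact_covarianceE], [process_covariance]).  In one rescaled
    mode the stationary covariances are [ds^-1] times the identity and
    [ds^-1] times the diagonal matrix with entries [1 / defect dt] and 1.  A
    comparison by means of the propagators alone would again produce [l^3] and
    thereby [ds^-5].  One factor [l] is saved by writing the identity as
    [osc_inv l + gamma / (2 * l) * swap_mx]: the exact flow multiplies
    [osc_inv l] by a scalar, and one step does the same up to an error of order
    [dt^3 * l^2] ([step_inv_defect]); the other summand loses [l^3] but carries
    the factor [1 / l] ([mode_covariance_error]).  The covariance of the scheme
    itself is computed by expanding its iterates in the noise variables
    ([process_expansion]), which are uncorrelated with variance 1.

    Both bounds are thus linear in [T], and [C * T <= expR (C * T)]. *)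

(** * Entrywise sum norm and telescoping *)

Section L1norm.
Context {R : realType}.
Implicit Types (p q r : nat).

Definition l1norm {p q} (A : 'M[R]_(p, q)) : R := \sum_i \sum_j `|A i j|.

Lemma l1norm_ge0 {p q} (A : 'M[R]_(p, q)) : 0 <= l1norm A.
Proof. by apply: sumr_ge0 => i _; apply: sumr_ge0. Qed.

Lemma l1normD {p q} (A B : 'M[R]_(p, q)) : l1norm (A + B) <= l1norm A + l1norm B.
Proof.
rewrite -big_split; apply: ler_sum => i _; rewrite -big_split /=.
by apply: ler_sum => j _; rewrite mxE ler_normD.
Qed.

Lemma l1normZ {p q} (a : R) (A : 'M[R]_(p, q)) : l1norm (a *: A) = `|a| * l1norm A.
Proof.
rewrite mulr_sumr; apply: eq_bigr => i _; rewrite mulr_sumr.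
by apply: eq_bigr => j _; rewrite mxE normrM.
Qed.

Lemma l1normN {p q} (A : 'M[R]_(p, q)) : l1norm (- A) = l1norm A.
Proof. by rewrite -scaleN1r l1normZ normrN1 mul1r. Qed.

Lemma l1normT {p q} (A : 'M[R]_(p, q)) : l1norm A^T = l1norm A.
Proof.
rewrite /l1norm exchange_big; apply: eq_bigr => i _.
by apply: eq_bigr => j _; rewrite mxE.
Qed.

Lemma ler_l1norm {p q} (A : 'M[R]_(p, q)) i j : `|A i j| <= l1norm A.
Proof.
rewrite /l1norm (bigD1 i)//= (bigD1 j)//= -addrA lerDl.
by rewrite addr_ge0// sumr_ge0// => k _; rewrite sumr_ge0.
Qed.

(** Submultiplicativity is the reason for the choice of the sum of all entries;
    it also dominates the Frobenius norm. *)
Lemma l1normM {p q r} (A : 'M[R]_(p, q)) (B : 'M[R]_(q, r)) :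
  l1norm (A *m B) <= l1norm A * l1norm B.
Proof.
rewrite mulr_suml; apply: ler_sum => i _.
apply: (@le_trans _ _ (\sum_j \sum_k `|A i k| * `|B k j|)).
  apply: ler_sum => j _; rewrite mxE (le_trans (ler_norm_sum _ _ _))//.
  by apply: ler_sum => k _; rewrite normrM.
rewrite exchange_big mulr_suml; apply: ler_sum => k _ /=.
rewrite -mulr_sumr ler_wpM2l// /l1norm (bigD1 k)//= lerDl.
by apply: sumr_ge0 => i' _; apply: sumr_ge0.
Qed.

Lemma l1normM_le {p q r} (A : 'M[R]_(p, q)) (B : 'M[R]_(q, r)) (a b : R) :
  l1norm A <= a -> l1norm B <= b -> l1norm (A *m B) <= a * b.
Proof.
by move=> hA hB; rewrite (le_trans (l1normM _ _))// ler_pM// l1norm_ge0.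
Qed.

Lemma pow_entry_le {p} (A : 'M[R]_p) (rho : R) k i j :
  l1norm A <= rho -> `|(A ^+ k) i j| <= rho ^+ k.
Proof.
move=> hA; have rho0 : 0 <= rho := le_trans (l1norm_ge0 A) hA.
elim: k i j => [|k IH] i j.
  by rewrite !expr0 mxE; case: (i == j); rewrite ?normr1 ?normr0.
rewrite exprS mxE (le_trans (ler_norm_sum _ _ _))//.
apply: (@le_trans _ _ (\sum_l `|A i l| * rho ^+ k)).
  by apply: ler_sum => l _; rewrite normrM ler_wpM2l.
rewrite -mulr_suml exprS ler_wpM2r ?exprn_ge0// (le_trans _ hA)//.
rewrite /l1norm [leRHS](bigD1 i)//= lerDl.
by apply: sumr_ge0 => i' _; apply: sumr_ge0.
Qed.

(** [A^m - B^m] is the sum of the [m] terms [A^j (A - B) B^(m - 1 - j)]; the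
    induction carries along the power [A^j] on the left. *)
Lemma pow_error_le {p} (A B : 'M[R]_p) (ka kb e : R) m :
  (forall k, l1norm (A ^+ k) <= ka) -> (forall k, l1norm (B ^+ k) <= kb) ->
  l1norm (A - B) <= e -> l1norm (A ^+ m - B ^+ m) <= m%:R * (ka * e * kb).
Proof.
move=> hA hB he; rewrite -[A ^+ m - _]mul1mx -[1%:M]/(A ^+ 0).
elim: m 0%N => [|m IH] j.
  by rewrite subrr mulmx0 mul0r /l1norm big1// => i _; rewrite big1// => i' _; rewrite mxE normr0.
have -> : A ^+ j *m (A ^+ m.+1 - B ^+ m.+1)
  = A ^+ j.+1 *m (A ^+ m - B ^+ m) + A ^+ j *m (A - B) *m B ^+ m.
  rewrite (exprS _ m) (exprS B m) (exprSr _ j) -!mulmxE !mulmxBr !mulmxBl !mulmxA.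
  by rewrite addrA subrK.
rewrite (le_trans (l1normD _ _))// -natr1 mulrDl mul1r lerD//.
by apply: l1normM_le => //; apply: l1normM_le.
Qed.

(** The same telescoping, for the map [X |-> A X A^T] against multiplication by
    the number [mu]. *)
Lemma congr_error_le {p} (A W : 'M[R]_p) (ka e mu : R) m :
  (forall k, l1norm (A ^+ k) <= ka) -> `|mu| <= 1 ->
  l1norm (A *m W *m A^T - mu *: W) <= e ->
  l1norm (A ^+ m *m W *m (A ^+ m)^T - mu ^+ m *: W) <= m%:R * (ka * e * ka).
Proof.
move=> hA hmu he; set D := fun m => A ^+ m *m W *m (A ^+ m)^T - mu ^+ m *: W.
have key j : l1norm (A ^+ j *m D m *m (A ^+ j)^T) <= m%:R * (ka * e * ka).
  elim: m j => [|m IH] j.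
    rewrite /D !expr0 trmx1 mul1mx mulmx1 scale1r subrr mulmx0 mul0mx mul0r.
    by rewrite /l1norm big1// => i _; rewrite big1// => i' _; rewrite mxE normr0.
  have -> : D m.+1 = A *m D m *m A^T + mu ^+ m *: (A *m W *m A^T - mu *: W).
    rewrite /D mulmxBr mulmxBl scalerBr scalerA -exprSr -scalemxAr -scalemxAl.
    by rewrite addrA subrK exprS -mulmxE trmx_mul !mulmxA.
  rewrite mulmxDr mulmxDl (le_trans (l1normD _ _))// -natr1 mulrDl mul1r.
  rewrite lerD//.
    have := IH j.+1; rewrite exprSr -mulmxE trmx_mul !mulmxA; exact.
  rewrite -scalemxAr -scalemxAl l1normZ normrX.
  have h : l1norm (A ^+ j *m (A *m W *m A^T - mu *: W) *m (A ^+ j)^T) <= ka * e * ka.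
    by apply: l1normM_le; [apply: l1normM_le|rewrite l1normT].
  rewrite (le_trans _ h)// ler_piMl ?l1norm_ge0//.
  by rewrite exprn_ile1.
by have := key 0%N; rewrite expr0 trmx1 mul1mx mulmx1.
Qed.

End L1norm.

(** * The matrix exponential *)

Section MatrixExp.
Context {R : realType}.

(** The series is dominated by that of [expR rho], and [1 / (k + 3)! <= 1 / k!]
    lets [rho^3] be pulled out of the terms from the third one on. *)
Lemma exp_tail3 (u : R^nat) (rho : R) : 0 <= rho ->
  (forall k, `|u k| <= rho ^+ k / k`!%:R) ->
  cvgn (series u) /\
  `|limn (series u) - (u 0%N + u 1%N + u 2%N)| <= rho ^+ 3 * expR rho.
Proof.
move=> rho0 hu.
have cu : cvgn (series u).
  apply: normed_cvg; apply: (@series_le_cvg _ _ (exp_coeff rho)).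
  - by move=> n /=.
  - by move=> n; apply: exp_coeff_ge0.
  - by move=> n; apply: hu.
  - exact: is_cvg_series_exp_coeff.
split=> //.
have le_exp n : series (exp_coeff rho) n <= expR rho.
  apply: nondecreasing_cvgn_le; last exact: is_cvg_series_exp_coeff.
  by apply: nondecreasing_series => k _ _; apply: exp_coeff_ge0.
have tailb n : `|series u (n + 3)%N - (u 0%N + u 1%N + u 2%N)| <= rho ^+ 3 * expR rho.
  rewrite /series /= addnC big_mkord big_split_ord /=.
  have -> : \sum_(i < 3) u (lshift n i) = u 0%N + u 1%N + u 2%N.
    by rewrite !big_ord_recl big_ord0 /= addr0 addrA.
  rewrite addrAC subrr add0r (le_trans (ler_norm_sum _ _ _))//.
  apply: (@le_trans _ _ (rho ^+ 3 * series (exp_coeff rho) n)); last first.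
    by rewrite ler_wpM2l ?exprn_ge0.
  rewrite /series /= big_mkord mulr_sumr; apply: ler_sum => i _.
  rewrite (le_trans (hu _))// /exp_coeff /= mulrA -exprD ler_wpM2l ?exprn_ge0//.
  rewrite lef_pV2 ?posrE ?ltr0n ?fact_gt0// ler_nat.
  by rewrite leq_fact// leq_addl.
have cv : (fun n => `|series u (n + 3)%N - (u 0%N + u 1%N + u 2%N)|) @ \oo
     --> `|limn (series u) - (u 0%N + u 1%N + u 2%N)|.
  apply: cvg_norm; apply: cvgB; last exact: cvg_cst.
  by rewrite cvg_shiftn.
rewrite -(cvg_lim _ cv)//; apply: limr_le.
  by apply: cvgP cv.
by near=> n; apply: tailb.
Unshelve. all: by end_near. Qed.

Lemma expR_taylor2 (x : R) : 0 <= x ->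
  `|expR (- x) - (1 - x + x ^+ 2 / 2)| <= x ^+ 3 * expR x.
Proof.
move=> x0; have [|_] := @exp_tail3 (exp_coeff (- x)) x x0.
  move=> k; rewrite /exp_coeff /= normrM normrX normrN ger0_norm//.
  by rewrite ger0_norm// invr_ge0.
rewrite /exp_coeff /= expr0 expr1 sqrrN !fact0 invr1 mulr1.
by rewrite mulr1.
Qed.

Lemma cvg_expmx {p} (A : 'M[R]_p) i j :
  series (fun k => (A ^+ k) i j / k`!%:R) @ \oo --> expmx A i j.
Proof.
rewrite mxE; have [|//] := @exp_tail3 (fun k => (A ^+ k) i j / k`!%:R) _ (l1norm_ge0 A).
move=> k; rewrite normrM [X in _ * X]ger0_norm ?invr_ge0//.
by rewrite ler_wpM2r ?invr_ge0// pow_entry_le.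
Qed.

Lemma expmx_taylor2 {p} (A : 'M[R]_p) (rho : R) : l1norm A <= rho ->
  l1norm (expmx A - (1%:M + A + 2^-1 *: (A *m A))) <= (p * p)%:R * (rho ^+ 3 * expR rho).
Proof.
move=> hA; have rho0 : 0 <= rho := le_trans (l1norm_ge0 A) hA.
have key i j : `|(expmx A - (1%:M + A + 2^-1 *: (A *m A))) i j| <= rho ^+ 3 * expR rho.
  have [|_] := @exp_tail3 (fun k => (A ^+ k) i j / k`!%:R) rho rho0.
    move=> k; rewrite normrM [X in _ * X]ger0_norm ?invr_ge0//.
    by rewrite ler_wpM2r ?invr_ge0// pow_entry_le.
  by rewrite fact0 invr1 expr0 expr1 expr2 -mulmxE !mxE [2^-1 * _]mulrC !mulr1.
rewrite natrM -mulrA /l1norm.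
apply: (@le_trans _ _ (\sum_(i < p) (p%:R * (rho ^+ 3 * expR rho)))).
  apply: ler_sum => i _.
  apply: (@le_trans _ _ (\sum_(j < p) (rho ^+ 3 * expR rho))).
    by apply: ler_sum => j _.
  by rewrite sumr_const card_ord mulr_natl.
by rewrite sumr_const card_ord [X in _ <= X]mulr_natl.
Qed.

Lemma cvg_bigsum {I : Type} (r : seq I) (u : I -> R^nat) (l : I -> R) :
  (forall i, u i n @[n --> \oo] --> l i) ->
  \sum_(i <- r) u i n @[n --> \oo] --> \sum_(i <- r) l i.
Proof.
move=> ul; elim: r => [|a r IH].
  by under eq_fun do rewrite big_nil; rewrite big_nil; apply: cvg_cst.
under eq_fun do rewrite big_cons.
by rewrite big_cons; apply: cvgD.
Qed.

(** A linear map is a finite combination of the entries of its argument, hence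
    commutes with the series. *)
Lemma cvg_linear_expmx {p r s} (f : {linear 'M[R]_p -> 'M[R]_(r, s)}) (A : 'M[R]_p) i j :
  series (fun k => f (A ^+ k) i j / k`!%:R) @ \oo --> f (expmx A) i j.
Proof.
have fE X : f X i j = \sum_(a < p) \sum_(b < p) X a b * f (delta_mx a b) i j.
  rewrite {1}[X]matrix_sum_delta linear_sum summxE; apply: eq_bigr => a _.
  by rewrite linear_sum summxE; apply: eq_bigr => b _; rewrite linearZ mxE.
rewrite fE.
have -> : series (fun k => f (A ^+ k) i j / k`!%:R)
  = (fun n => \sum_(a < p) \sum_(b < p)
      series (fun k => (A ^+ k) a b / k`!%:R) n * f (delta_mx a b) i j).
  apply/funext => n; rewrite /series /=.
  under eq_bigr do rewrite fE mulr_suml.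
  rewrite exchange_big; apply: eq_bigr => a _.
  under eq_bigr do rewrite mulr_suml.
  rewrite exchange_big; apply: eq_bigr => b _.
  by rewrite mulr_suml; apply: eq_bigr => k _; rewrite mulrAC.
apply: cvg_bigsum => a; apply: cvg_bigsum => b.
by apply: cvgMr_tmp; apply: cvg_expmx.
Qed.

(** Reduces linear identities about the exponential to identities about powers. *)
Lemma linear_expmx_eq {p r s} (f g : {linear 'M[R]_p -> 'M[R]_(r, s)}) (A : 'M[R]_p) :
  (forall k, f (A ^+ k) = g (A ^+ k)) -> f (expmx A) = g (expmx A).
Proof.
move=> fg; apply/matrixP => i j.
have cf := @cvg_linear_expmx _ _ _ f A i j; have cg := @cvg_linear_expmx _ _ _ g A i j.
move: cf; under [in X in X -> _]eq_fun do rewrite fg.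
by move=> cf; apply: (cvg_unique _ cf cg).
Qed.

Lemma expmx_comm {p} (A : 'M[R]_p) : A *m expmx A = expmx A *m A.
Proof.
apply: (@linear_expmx_eq _ _ _ (mulmx A) (mulmxr A)) => k /=.
by rewrite !mulmxE -exprS exprSr.
Qed.

Lemma expmx_conj {p q} (V : 'M[R]_(p, q)) (V' : 'M[R]_(q, p)) (A : 'M[R]_q) :
  V *m V' = 1%:M -> V' *m V = 1%:M ->
  expmx (V *m A *m V') = V *m expmx A *m V'.
Proof.
move=> VV' V'V; apply/matrixP => i j.
have E k : V *m A ^+ k *m V' = (V *m A *m V') ^+ k.
  elim: k => [|k IH]; first by rewrite !expr0 mulmx1 VV'.
  rewrite !exprS -IH -!mulmxE !mulmxA; congr (_ *m _ *m _).
  by rewrite -[RHS]mulmxA V'V mulmx1.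
pose f : {linear 'M[R]_q -> 'M[R]_p} := (mulmxr V' \o mulmx V)%FUN.
have := @cvg_linear_expmx _ _ _ f A i j; rewrite /=.
under [in X in X -> _]eq_fun do rewrite E.
by move=> cf; apply: (cvg_unique _ (@cvg_expmx _ _ i j) cf).
Qed.

End MatrixExp.

(** * Flow of a linear differential equation *)

Section MatrixExpFlow.
Context {R : realType}.

Lemma exprZmx {p} (a : R) (A : 'M[R]_p) k : (a *: A) ^+ k = a ^+ k *: A ^+ k.
Proof.
elim: k => [|k IH]; first by rewrite !expr0 scale1r.
by rewrite !exprS IH -!mulmxE -scalemxAl -scalemxAr scalerA.
Qed.

Definition is_mxderive {p q} (X : R -> 'M[R]_(p, q)) (t : R) (dX : 'M[R]_(p, q)) :=
  forall i j, is_derive t 1 (fun t => X t i j) (dX i j).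

(** Entrywise, the exponential is a power series in [t] that converges
    everywhere together with its formal derivatives. *)
Lemma is_mxderive_expmx {p} (A : 'M[R]_p) t :
  is_mxderive (fun t => expmx (t *: A)) t (A *m expmx (t *: A)).
Proof.
move=> i j.
pose c (f : 'M[R]_p -> 'M[R]_p) k := f (A ^+ k) i j / k`!%:R.
have cvgf (f : {linear 'M[R]_p -> 'M[R]_p}) (x : R) :
    pseries (c f) x @ \oo --> f (expmx (x *: A)) i j.
  have := @cvg_linear_expmx _ _ _ _ f (x *: A) i j.
  rewrite (_ : (fun k => _) = (fun k => c f k * x ^+ k))//.
  by apply/funext => k; rewrite exprZmx linearZ mxE /c -mulrA mulrC.
have dc (f : {linear 'M[R]_p -> 'M[R]_p}) :
    pseries_diffs (c f) = c (f \o mulmx A)%FUN.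
  apply/funext => k; rewrite /pseries_diffs /c /= exprS -mulmxE factS natrM.
  by rewrite invfM mulrCA mulVKf.
pose m1 : {linear 'M[R]_p -> 'M[R]_p} := (idfun \o mulmx A)%FUN.
pose m2 : {linear 'M[R]_p -> 'M[R]_p} := (m1 \o mulmx A)%FUN.
have := @pseries_snd_diffs R (c idfun) (`|t| + 1) t.
rewrite (dc idfun) (dc m1).
move=> /(_ (cvgP _ (cvgf idfun _)) (cvgP _ (cvgf m1 _)) (cvgP _ (cvgf m2 _))).
have -> : (fun x => limn (pseries (c idfun) x)) = (fun x => expmx (x *: A) i j).
  by apply/funext => x; apply: cvg_lim (cvgf idfun x).
rewrite (cvg_lim _ (cvgf m1 t))//=; apply.
by rewrite [X in _ < X]ger0_norm ?ltrDl// addr_ge0.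
Qed.

Lemma is_mxderiveM {p q r} (X : R -> 'M[R]_(p, q)) (Y : R -> 'M[R]_(q, r)) t dX dY :
  is_mxderive X t dX -> is_mxderive Y t dY ->
  is_mxderive (fun t => X t *m Y t) t (dX *m Y t + X t *m dY).
Proof.
move=> hX hY i j.
rewrite (_ : (fun t => _) = \sum_(k < q) (fun t => X t i k * Y t k j)); last first.
  by apply/funext => x; rewrite mxE fct_sumE.
have := @is_derive_sum _ _ _ q (fun k t => X t i k * Y t k j) t 1
   (fun k => X t i k * dY k j + Y t k j * dX i k).
rewrite !mxE -big_split /=.
rewrite (eq_bigr (fun k => dX i k * Y t k j + X t i k * dY k j)).
  apply=> k; apply: is_deriveM; [exact: hX|exact: hY].
by move=> k _; rewrite addrC [_ * dX _ _]mulrC.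
Qed.

Lemma is_mxderive_comp_sub {p q} (X : R -> 'M[R]_(p, q)) (s t : R) dX :
  is_mxderive X (s - t) dX -> is_mxderive (fun t => X (s - t)) t (- dX).
Proof.
move=> hX i j; rewrite mxE.
have h2 : is_derive t 1 (fun t : R => s - t) (- 1).
  have := @is_deriveB _ _ _ (cst s) id t 1 0 1 (is_derive_cst _ _ _) (is_derive_id _ _).
  by rewrite sub0r.
have := @is_derive1_comp R (fun t => X t i j) (fun t => s - t) t _ _ (hX i j) h2.
by rewrite mulrN1.
Qed.

Lemma is_mxderive_trmx {p q} (X : R -> 'M[R]_(p, q)) t dX :
  is_mxderive X t dX -> is_mxderive (fun t => (X t)^T) t dX^T.
Proof.
move=> hX i j; rewrite mxE (_ : (fun t => _) = (fun t => X t j i)) ?hX//.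
by apply/funext => x; rewrite mxE.
Qed.

Lemma is_mxderive0_cst {p q} (X : R -> 'M[R]_(p, q)) s t :
  (forall t, is_mxderive X t 0) -> X s = X t.
Proof.
move=> hX; apply/matrixP => i j.
apply: (@is_derive_0_is_cst _ (fun t => X t i j)) => x.
by have := hX x i j; rewrite mxE.
Qed.

Lemma expmx0 {p} : expmx (0 : 'M[R]_p) = 1%:M.
Proof.
have z0 : l1norm (0 : 'M[R]_p) <= 0.
  by rewrite /l1norm big1// => i _; rewrite big1// => j _; rewrite mxE normr0.
have := expmx_taylor2 z0; rewrite mul0mx scaler0 !addr0 expr0n/= mul0r mulr0 => h.
apply/eqP; rewrite -subr_eq0; apply/eqP/matrixP => i j; rewrite [RHS]mxE.
by apply/eqP; rewrite -normr_le0 (le_trans (ler_l1norm _ _ _)).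
Qed.

(** The left-hand side has derivative zero in [t], so that [t] may be replaced
    by 0. *)
Lemma expmx_sub {p} (A : 'M[R]_p) (s t : R) :
  expmx ((s - t) *: A) *m expmx (t *: A) = expmx (s *: A).
Proof.
rewrite (@is_mxderive0_cst _ _ (fun t => expmx ((s - t) *: A) *m expmx (t *: A)) t 0).
  by rewrite subr0 scale0r expmx0 mulmx1.
move=> x; have h1 := is_mxderive_comp_sub (is_mxderive_expmx A (s - x)).
have := is_mxderiveM h1 (is_mxderive_expmx A x).
rewrite mulNmx [X in - (X *m _)](_ : _ = expmx ((s - x) *: A) *m A).
  by rewrite mulmxA addNr.
have [->|nz] := eqVneq (s - x) 0; first by rewrite scale0r expmx0 mulmx1 mul1mx.
have := expmx_comm ((s - x) *: A).
by rewrite -scalemxAl -scalemxAr => /(scalerI nz).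
Qed.

Lemma expmx_commZ {p} (A : 'M[R]_p) (t : R) :
  A *m expmx (t *: A) = expmx (t *: A) *m A.
Proof.
have [->|nz] := eqVneq t 0; first by rewrite scale0r expmx0 mulmx1 mul1mx.
have := expmx_comm (t *: A).
by rewrite -scalemxAl -scalemxAr => /(scalerI nz).
Qed.

Lemma expmx_natmul {p} (A : 'M[R]_p) (t : R) m :
  expmx ((m%:R * t) *: A) = expmx (t *: A) ^+ m.
Proof.
elim: m => [|m IH]; first by rewrite mul0r scale0r expmx0 expr0.
rewrite exprSr -IH -mulmxE -[m%:R * t](_ : m.+1%:R * t - t = _) ?expmx_sub//.
by rewrite -natr1 mulrDl mul1r addrK.
Qed.

(** For [F = expmx (t *: K)], the derivative of [expR (gamma * t) *: F W F^T] is
    [expR (gamma * t) *: F (K W + W K^T + gamma *: W) F^T], which vanishes. *)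
Lemma expmx_lyapunov {p} (K W : 'M[R]_p) (gamma t : R) :
  K *m W + W *m K^T = - gamma *: W ->
  expmx (t *: K) *m W *m (expmx (t *: K))^T = expR (- (gamma * t)) *: W.
Proof.
move=> KW; set F := fun t => expmx (t *: K).
pose Y x := F x *m (expR (gamma * x) *: W) *m (F x)^T.
have Yc : Y t = Y 0.
  apply: is_mxderive0_cst => x.
  have dF := is_mxderive_expmx K x.
  have de : is_mxderive (fun x => expR (gamma * x) *: W) x ((gamma * expR (gamma * x)) *: W).
    move=> i j; rewrite mxE (_ : (fun t => _) = (fun t => W i j *: expR (gamma * t))); last first.
      by apply/funext => y; rewrite mxE mulrC.
    rewrite mulrC; apply: is_deriveZ; rewrite mulrC.
    have h : is_derive x 1 (fun t : R => gamma * t) gamma.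
      have := @is_deriveZ _ _ _ id gamma x 1 1 (is_derive_id _ _).
      by rewrite [gamma *: 1]mulr1.
    exact: is_derive1_comp.
  have := is_mxderiveM (is_mxderiveM dF de) (is_mxderive_trmx dF).
  rewrite (_ : (_ + _) = 0)// expmx_commZ trmx_mul -/(F x).
  set e := expR _.
  have -> : F x *m K *m (e *: W) + F x *m (gamma * e *: W)
      = F x *m (e *: (K *m W + gamma *: W)).
    by rewrite scalerDr scalerA [e * _]mulrC mulmxDr scalemxAr mulmxA.
  have -> : F x *m (e *: W) *m (K^T *m (F x)^T) = F x *m (e *: (W *m K^T)) *m (F x)^T.
    by rewrite !mulmxA -!scalemxAr -!scalemxAl !mulmxA.
  rewrite -mulmxDl -mulmxDr -scalerDr addrAC KW scaleNr addNr.
  by rewrite scaler0 mulmx0 mul0mx.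
have : expR (- (gamma * t)) *: Y t = expR (- (gamma * t)) *: W.
  by rewrite Yc /Y /F mulr0 expR0 scale1r scale0r expmx0 trmx1 mulmx1 mul1mx.
by rewrite /Y -scalemxAr -scalemxAl scalerA -expRD addNr expR0 scale1r.
Qed.

End MatrixExpFlow.

(** * The damped oscillator *)

Section Mx2.
Context {R : realType}.
Implicit Types a b c d : R.

Definition mx2 a b c d : 'M[R]_2 :=
  \matrix_(i, j) if i == 0 then if j == 0 then a else b
                 else if j == 0 then c else d.

Lemma ord2P (i : 'I_2) : i = 0 \/ i = 1.
Proof.
have /orP[/eqP ->|/eqP ->] : (i == 0) || (i == 1); [|by left|by right].
by rewrite -!val_eqE; case: i => [[|[|m]] //].
Qed.

Lemma ord2_lift0 : lift ord0 ord0 = 1 :> 'I_2.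
Proof. by apply/eqP; rewrite -val_eqE. Qed.

Lemma mx2P (A B : 'M[R]_2) : A 0 0 = B 0 0 -> A 0 1 = B 0 1 ->
  A 1 0 = B 1 0 -> A 1 1 = B 1 1 -> A = B.
Proof.
move=> h00 h01 h10 h11; apply/matrixP => i j.
by case: (ord2P i) => ->; case: (ord2P j) => ->.
Qed.

Lemma mulmx2E (A B : 'M[R]_2) i j : (A *m B) i j = A i 0 * B 0 j + A i 1 * B 1 j.
Proof.
rewrite mxE !big_ord_recl big_ord0 addr0.
by rewrite ord2_lift0.
Qed.

Lemma mulmx2 a b c d a' b' c' d' : mx2 a b c d *m mx2 a' b' c' d' =
  mx2 (a * a' + b * c') (a * b' + b * d') (c * a' + d * c') (c * b' + d * d').
Proof. by apply: mx2P; rewrite mulmx2E !mxE. Qed.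

Lemma addmx2 a b c d a' b' c' d' : mx2 a b c d + mx2 a' b' c' d' =
  mx2 (a + a') (b + b') (c + c') (d + d').
Proof. by apply: mx2P; rewrite !mxE. Qed.

Lemma oppmx2 a b c d : - mx2 a b c d = mx2 (- a) (- b) (- c) (- d).
Proof. by apply: mx2P; rewrite !mxE. Qed.

Lemma scalemx2 k a b c d : k *: mx2 a b c d = mx2 (k * a) (k * b) (k * c) (k * d).
Proof. by apply: mx2P; rewrite !mxE. Qed.

Lemma trmx2 a b c d : (mx2 a b c d)^T = mx2 a c b d.
Proof. by apply: mx2P; rewrite !mxE. Qed.

Lemma mx2_1 : 1%:M = mx2 1 0 0 1.
Proof. by apply: mx2P; rewrite !mxE. Qed.

Lemma eq_mx2 a b c d a' b' c' d' : a = a' -> b = b' -> c = c' -> d = d' ->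
  mx2 a b c d = mx2 a' b' c' d'.
Proof. by move=> -> -> -> ->. Qed.

Lemma l1norm_mx2 (A : 'M[R]_2) :
  l1norm A = `|A 0 0| + `|A 0 1| + `|A 1 0| + `|A 1 1|.
Proof.
rewrite /l1norm !big_ord_recl !big_ord0 !addr0 !addrA.
by rewrite ord2_lift0.
Qed.

Lemma l1norm_mx2_le (A : 'M[R]_2) (e : R) :
  (forall i j, `|A i j| <= e) -> l1norm A <= 4 * e.
Proof.
move=> h; rewrite l1norm_mx2.
have := h 0 0; have := h 0 1; have := h 1 0; have := h 1 1; lra.
Qed.

Lemma sum_sqr_le1 (a b B : R) : 1 <= B -> a ^+ 2 + b ^+ 2 <= B -> `|a| <= B.
Proof.
move=> B1 h; rewrite ler_norml; apply/andP.
have := sqr_ge0 b; have := sqr_ge0 (a - 1); have := sqr_ge0 (a + 1); split; nra.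
Qed.

End Mx2.

Section Oscillator.
Context {R : realType}.
Implicit Types gamma h l t : R.

Definition osc_mx gamma l : 'M[R]_2 := mx2 0 l (- l) (- gamma).

(** For a column [(x, y)] of the flow, the derivative of [x^2 + y^2] is
    [- 2 * gamma * y^2]: the rotation by [l] does not contribute. *)
Lemma osc_flow_bounded gamma l t : 0 <= gamma -> 0 <= t ->
  l1norm (expmx (t *: osc_mx gamma l)) <= 4.
Proof.
move=> g0 t0; set F := fun t => expmx (t *: osc_mx gamma l).
have dF (x : R) (j : 'I_2) :
    is_derive x 1 (fun x => F x 0 j) (l * F x 1 j) /\
    is_derive x 1 (fun x => F x 1 j) (- l * F x 0 j - gamma * F x 1 j).
  have := is_mxderive_expmx (osc_mx gamma l) x; rewrite -/(F x) => D.
  split; [apply: is_derive_eq (D 0 j) _|apply: is_derive_eq (D 1 j) _].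
    by rewrite mulmx2E [osc_mx _ _ 0 0]mxE [osc_mx _ _ 0 1]mxE /= mul0r add0r.
  by rewrite mulmx2E [osc_mx _ _ 1 0]mxE [osc_mx _ _ 1 1]mxE /= !mulNr.
have bnd j : F t 0 j ^+ 2 + F t 1 j ^+ 2 <= 1.
  pose N x := F x 0 j ^+ 2 + F x 1 j ^+ 2.
  have dN (x : R) : is_derive x 1 N (- (2 * gamma * F x 1 j ^+ 2)).
    have [d0 d1] := dF x j.
    rewrite (_ : N = (fun x => F x 0 j) ^+ 2 + (fun x => F x 1 j) ^+ 2)//.
    apply: is_derive_eq (is_deriveD (is_deriveX 2 d0) (is_deriveX 2 d1)) _.
    transitivity (2 * F x 0 j * (l * F x 1 j)
      + 2 * F x 1 j * (- l * F x 0 j - gamma * F x 1 j)); first by [].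
    ring.
  have cN : {within `[0, t], continuous N}.
    apply: continuous_subspaceT => x; apply: differentiable_continuous.
    by apply/derivable1_diffP; have := dN x.
  have [c _ E] := MVT_segment t0 (fun x _ => dN x) cN.
  have : N t <= N 0.
    by rewrite -subr_le0 E subr0 mulNr oppr_le0 mulr_ge0// mulr_ge0 ?sqr_ge0 ?mulr_ge0.
  move=> /le_trans; apply; rewrite /N /F scale0r expmx0 !mxE.
  by have [->|->] := ord2P j; rewrite /= ?expr1n ?expr0n /= ?addr0 ?add0r.
rewrite -[4]mulr1; apply: l1norm_mx2_le => i j; have := bnd j.
have [->|->] := ord2P i.
  exact: sum_sqr_le1.
by rewrite addrC; apply: sum_sqr_le1.
Qed.

End Oscillator.

(** * Uniform order estimates and the one-mode step *)

Section BigO.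
Context {R : realType}.
Implicit Types (D : R -> R -> Prop) (f g Y Z : R -> R -> R).

(** The constant is uniform in both variables over the domain [D]; in the
    application these are the time step [h] and the frequency [l]. *)
Definition bigO D f Y := exists2 C : R, 0 <= C & forall h l, D h l -> `|f h l| <= C * Y h l.

Definition bigOmx {p q} D (A : R -> R -> 'M[R]_(p, q)) Y := exists2 C : R, 0 <= C &
  forall h l, D h l -> l1norm (A h l) <= C * Y h l.

Lemma bigO_triv D f : (forall h l, D h l -> 0 <= f h l) -> bigO D f f.
Proof. by move=> h0; exists 1 => // h l /h0 ?; rewrite mul1r ger0_norm. Qed.

Lemma bigOD D f g Y : bigO D f Y -> bigO D g Y -> bigO D (fun h l => f h l + g h l) Y.
Proof.
move=> [C C0 hC] [C' C0' hC']; exists (C + C'); first exact: addr_ge0.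
move=> h l d; rewrite mulrDl (le_trans (ler_normD _ _))// lerD ?hC ?hC'//.
Qed.

Lemma bigON D f Y : bigO D f Y -> bigO D (fun h l => - f h l) Y.
Proof. by move=> [C C0 hC]; exists C => // h l d; rewrite normrN hC. Qed.

Lemma bigOM D f g Y Z : bigO D f Y -> bigO D g Z ->
  bigO D (fun h l => f h l * g h l) (fun h l => Y h l * Z h l).
Proof.
move=> [C C0 hC] [C' C0' hC']; exists (C * C'); first exact: mulr_ge0.
by move=> h l d; rewrite normrM mulrACA ler_pM ?hC ?hC'.
Qed.

Lemma bigO_le D f Y Z (k : R) : 0 <= k -> (forall h l, D h l -> Y h l <= k * Z h l) ->
  bigO D f Y -> bigO D f Z.
Proof.
move=> k0 YZ [C C0 hC]; exists (C * k); first exact: mulr_ge0.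
by move=> h l d; rewrite (le_trans (hC _ _ d))// -mulrA ler_wpM2l// YZ.
Qed.

Lemma bigO_ext D f g Y : (forall h l, D h l -> f h l = g h l) -> bigO D f Y -> bigO D g Y.
Proof. by move=> fg [C C0 hC]; exists C => // h l d; rewrite -fg// hC. Qed.

Lemma bigO_ext_le D f g Y Z : bigO D f Y ->
  (forall h l, D h l -> f h l = g h l /\ Y h l <= Z h l) -> bigO D g Z.
Proof.
move=> [C C0 hC] fg; exists C => // h l d; have [<- YZ] := fg _ _ d.
by rewrite (le_trans (hC _ _ d))// ler_wpM2l.
Qed.

Lemma bigO_cst D (c : R) : bigO D (fun _ _ => c) (fun _ _ => 1).
Proof. by exists `|c| => // h l _; rewrite mulr1. Qed.

Lemma bigOMl D (c : R) f Y : bigO D f Y -> bigO D (fun h l => c * f h l) Y.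
Proof.
move=> hf; have := bigOM (bigO_cst D c) hf.
by apply: (bigO_le ler01) => h l _; rewrite !mul1r.
Qed.

Lemma bigO_bounded_Ml D f g Y : bigO D f (fun _ _ => 1) -> bigO D g Y ->
  bigO D (fun h l => f h l * g h l) Y.
Proof.
move=> hf hg; have := bigOM hf hg.
by apply: (bigO_le ler01) => h l _; rewrite !mul1r.
Qed.

Lemma bigO_bounded_Mr D f g Y : bigO D f Y -> bigO D g (fun _ _ => 1) ->
  bigO D (fun h l => f h l * g h l) Y.
Proof.
move=> hf hg; have := bigOM hf hg.
by apply: (bigO_le ler01) => h l _; rewrite mulr1 mul1r.
Qed.

Lemma bigOmx_mx2 D (a b c d : R -> R -> R) Y :
  bigO D a Y -> bigO D b Y -> bigO D c Y -> bigO D d Y ->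
  bigOmx D (fun h l => mx2 (a h l) (b h l) (c h l) (d h l)) Y.
Proof.
move=> [A A0 hA] [B B0 hB] [C C0 hC] [E E0 hE].
exists (A + B + C + E); first by rewrite !addr_ge0.
by move=> h l d'; rewrite l1norm_mx2 !mxE/= !mulrDl !lerD ?hA ?hB ?hC ?hE.
Qed.

Lemma bigOmxD {p q} D (A B : R -> R -> 'M[R]_(p, q)) Y : bigOmx D A Y -> bigOmx D B Y ->
  bigOmx D (fun h l => A h l + B h l) Y.
Proof.
move=> [C C0 hC] [C' C0' hC']; exists (C + C'); first exact: addr_ge0.
move=> h l d; rewrite mulrDl (le_trans (l1normD _ _))// lerD ?hC ?hC'//.
Qed.

Lemma bigOmxN {p q} D (A : R -> R -> 'M[R]_(p, q)) Y : bigOmx D A Y ->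
  bigOmx D (fun h l => - A h l) Y.
Proof. by move=> [C C0 hC]; exists C => // h l d; rewrite l1normN hC. Qed.

Lemma bigOmx_ext {p q} D (A B : R -> R -> 'M[R]_(p, q)) Y :
  (forall h l, D h l -> A h l = B h l) -> bigOmx D A Y -> bigOmx D B Y.
Proof. by move=> fg [C C0 hC]; exists C => // h l d; rewrite -fg// hC. Qed.

End BigO.

Section LocalError.
Context {R : realType}.
Variables (gamma q0 : R).
Hypothesis gamma_gt0 : 0 < gamma.

(** The splitting preserves [defect h * x^2 + y^2] where the undamped exact
    flow preserves [x^2 + y^2]. *)
Definition defect (h : R) : R := 1 - h ^+ 2 / 4.
Definition cay_inv (h l : R) : R := (1 + ((h * l) ^+ 2 - h ^+ 2) / 4)^-1.
(** [cay_cos h l] is the cosine of the angle by which the splitting turns the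
    mode of frequency [l]; [sqrt (defect h) * cay_sin h l] is its sine. *)
Definition cay_cos (h l : R) : R := 1 - (h * l) ^+ 2 * cay_inv h l / 2.
Definition cay_sin (h l : R) : R := h * l * cay_inv h l.
Definition damp (g h : R) : R := expR (- (g * h / 2)).

Definition step_mx (g h l : R) : 'M[R]_2 :=
  mx2 (cay_cos h l) (damp g h * cay_sin h l)
      (- (damp g h * defect h * cay_sin h l)) (damp g h ^+ 2 * cay_cos h l).

Definition admissible (h l : R) : Prop := [/\ 0 < h, h < 2, 1 <= l & q0 <= defect h].
Local Notation q := defect.
Local Notation y := cay_inv.
Local Notation c := cay_cos.
Local Notation s := cay_sin.
Local Notation e := (damp gamma).
Local Notation u := (fun h : R => gamma * h / 2).

Lemma cay_den_ge1 (h l : R) : 1 <= l -> 1 <= 1 + ((h * l) ^+ 2 - h ^+ 2) / 4.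
Proof.
move=> l1; have l2 : 0 <= l ^+ 2 - 1 by rewrite subr_ge0 exprn_ege1.
by have := mulr_ge0 (sqr_ge0 h) l2; rewrite exprMn; lra.
Qed.

Lemma cay_invE (h l : R) : 1 <= l -> cay_inv h l * (1 + ((h * l) ^+ 2 - h ^+ 2) / 4) = 1.
Proof. by move=> /(cay_den_ge1 h) ?; rewrite mulVf// gt_eqF// (lt_le_trans ltr01). Qed.

Lemma cay_inv_bounds (h l : R) : 1 <= l ->
  [/\ 0 < y h l, y h l <= 1 & 1 - y h l <= (h * l) ^+ 2 / 4].
Proof.
move=> l1; have E := cay_invE h l1; have h1 := cay_den_ge1 h l1.
have y0 : 0 < y h l by rewrite invr_gt0 (lt_le_trans ltr01).
have y1 : y h l <= 1 by rewrite invf_le1 ?(lt_le_trans ltr01).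
by split => //; have := sqr_ge0 h; have := sqr_ge0 (h * l); nra.
Qed.

Lemma cay_cos_sin (h l : R) : 1 <= l -> c h l ^+ 2 + q h * s h l ^+ 2 = 1.
Proof.
move=> l1; have E := cay_invE h l1; rewrite /c /s /q.
set x := h * l in E *; set Y := cay_inv _ _ in E *.
have -> : (1 - x ^+ 2 * Y / 2) ^+ 2 + (1 - h ^+ 2 / 4) * (x * Y) ^+ 2
  = 1 + x ^+ 2 * Y * (Y * (1 + (x ^+ 2 - h ^+ 2) / 4) - 1) by field.
by rewrite E subrr mulr0 addr0.
Qed.

Lemma damp_bounds (h : R) : 0 < h ->
  [/\ 0 < e h, e h <= 1, 1 - e h <= u h & `|e h - 1 + u h| <= u h ^+ 2].
Proof.
move=> h0; rewrite /damp /=; set v := gamma * h / 2.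
have v0 : 0 < v by rewrite divr_gt0 ?mulr_gt0.
have e0 := expR_gt0 (- v); have e1 := expR_ge1Dx (- v).
have e2 : expR (- v) * (1 + v) <= 1.
  by rewrite expRN ler_pdivrMl ?expR_gt0// mulr1 expR_ge1Dx.
split => //; [nra|nra|rewrite ler_norml; apply/andP; split; nra].
Qed.

Lemma damp_third_order (h : R) : 0 < h -> h < 2 ->
  `|e h ^+ 2 - (1 - 2 * u h + 2 * u h ^+ 2)| <= gamma ^+ 3 * expR (2 * gamma) * h ^+ 3 /\
  `|e h - (1 - u h + u h ^+ 2 / 2)| <= gamma ^+ 3 * expR (2 * gamma) * h ^+ 3.
Proof.
move=> h0 h2.
(* to be used for [k = 1] and [k = 1 / 2] *)
have key (k : R) : 0 <= k -> k <= 1 -> `|expR (- (k * gamma * h)) -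
    (1 - k * gamma * h + (k * gamma * h) ^+ 2 / 2)| <= gamma ^+ 3 * expR (2 * gamma) * h ^+ 3.
  move=> k0 k1; have kg : 0 <= k * gamma * h by rewrite !mulr_ge0// ltW.
  have kgh : k * gamma * h <= gamma * h by rewrite -mulrA ler_piMl// mulr_ge0// ltW.
  apply: (le_trans (expR_taylor2 kg)); rewrite [leRHS]mulrAC -exprMn ler_pM ?exprn_ge0 ?expR_ge0//.
    by rewrite lerXn2r// nnegrE (le_trans kg kgh).
  by rewrite ler_expR (le_trans kgh)// mulrC ler_wpM2r// ltW.
split.
  have := key 1 ler01 (lexx _); rewrite mul1r /damp -expRM_natl /=.
  rewrite (_ : - (gamma * h) = 2 * (- (gamma * h / 2))); last by field.
  by rewrite [X in `|_ - X|](_ : _ = 1 - 2 * (gamma * h / 2) + 2 * (gamma * h / 2) ^+ 2)//; field.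
have := key 2^-1; rewrite invr_ge0 ler0n => /(_ isT).
have -> : 2^-1 * gamma * h = gamma * h / 2 by field.
by apply; rewrite invf_le1// ler1n.
Qed.

End LocalError.

(** * Local error and stability of one mode *)

Section LocalErrorBounds.
Context {R : realType}.
Variables (gamma q0 : R).
Hypotheses (gamma_gt0 : 0 < gamma) (q0_gt0 : 0 < q0).
Local Notation D := (admissible q0).
Local Notation q := defect.
Local Notation y := cay_inv.
Local Notation c := cay_cos.
Local Notation s := cay_sin.
Local Notation e := (damp gamma).
Local Notation one := (fun _ _ : R => 1 : R).
Local Notation hh := (fun h _ : R => h).
Local Notation x := (fun h l : R => h * l).

Lemma admissible_bounds h l : D h l ->
  [/\ 0 < h, h < 2, 1 <= l, 0 < h * l & h <= h * l].
Proof.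
move=> [h0 h2 l1 _]; split=> //; first by rewrite mulr_gt0// (lt_le_trans ltr01).
by rewrite ler_peMr// ltW.
Qed.

Lemma bigO_half_damping : bigO D (fun h _ => gamma * h / 2) hh.
Proof.
exists gamma; first exact: ltW.
by move=> h l [h0 _ _ _]; have := mulr_gt0 gamma_gt0 h0 => gh; rewrite ger0_norm; lra.
Qed.

Lemma bigO_h : bigO D hh hh.
Proof. by apply: bigO_triv => h l [/ltW]. Qed.

Lemma bigO_hl : bigO D x x.
Proof. by apply: bigO_triv => h l /admissible_bounds[_ _ _ /ltW]. Qed.

Lemma bigO_h1 : bigO D hh one.
Proof. by exists 2 => // h l [h0 h2 _ _]; rewrite mulr1 ger0_norm ltW. Qed.

Lemma bigO_damp : bigO D (fun h _ => e h) one.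
Proof.
by exists 1 => // h l [/(damp_bounds gamma_gt0)[e0 e1 _ _] _ _ _]; rewrite mulr1 ger0_norm ?(ltW e0).
Qed.

Lemma bigO_1Bdamp : bigO D (fun h _ => 1 - e h) hh.
Proof.
exists gamma; first exact: ltW.
move=> h l [h0 _ _ _]; have [e0 e1 e2 _] := damp_bounds gamma_gt0 h0.
have := mulr_gt0 gamma_gt0 h0 => gh; rewrite ger0_norm; lra.
Qed.

Lemma bigO_damp_taylor1 : bigO D (fun h _ => e h - 1 + gamma * h / 2) (fun h _ => h ^+ 2).
Proof.
exists (gamma ^+ 2); first exact: sqr_ge0.
move=> h l [h0 _ _ _]; have [_ _ _ e2] := damp_bounds gamma_gt0 h0.
rewrite (le_trans e2)// -exprMn ler_sqr ?nnegrE ?divr_ge0 ?mulr_ge0 ?ltW//.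
by rewrite ltr_pdivrMr// ltr_pMr ?mulr_gt0// ltr1n.
Qed.

Lemma bigO_damp_sqr_taylor2 : bigO D
  (fun h _ => e h ^+ 2 - (1 - 2 * (gamma * h / 2) + 2 * (gamma * h / 2) ^+ 2))
  (fun h _ => h ^+ 3).
Proof.
exists (gamma ^+ 3 * expR (2 * gamma)).
  by rewrite mulr_ge0 ?expR_ge0// exprn_ge0// ltW.
by move=> h l [h0 h2 _ _]; have [] := damp_third_order gamma_gt0 h0 h2.
Qed.

(** The quantity is [damp] times [2 * sinh (gamma * h / 2) - gamma * h], in
    which the second-order terms cancel. *)
Lemma bigO_damp_sinh : bigO D (fun h _ => 1 - e h ^+ 2 - gamma * h * e h) (fun h _ => h ^+ 3).
Proof.
have r1 : bigO D (fun h _ => e h - (1 - gamma * h / 2 + (gamma * h / 2) ^+ 2 / 2))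
    (fun h _ => h ^+ 3).
  exists (gamma ^+ 3 * expR (2 * gamma)).
    by rewrite mulr_ge0 ?expR_ge0// exprn_ge0// ltW.
  by move=> h l [h0 h2 _ _]; have [] := damp_third_order gamma_gt0 h0 h2.
have u1 := bigO_half_damping; have h1 := bigO_h1.
have u3 : bigO D (fun h _ => - (gamma * h / 2) ^+ 3) (fun h _ => h ^+ 3).
  apply: (bigO_le ler01) (bigON (bigOM u1 (bigOM u1 u1))) => h l _.
  by rewrite mul1r !exprS expr0 mulr1.
have ur : bigO D (fun h _ => - (2 * (gamma * h / 2) *
    (e h - (1 - gamma * h / 2 + (gamma * h / 2) ^+ 2 / 2)))) (fun h _ => h ^+ 3).
  apply: bigON; apply: bigO_bounded_Ml r1; apply: bigOMl.
  by apply: (bigO_le (ler0n _ 2)) u1 => h l [_ /ltW]; rewrite mulr1.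
apply: bigO_ext (bigOD (bigON bigO_damp_sqr_taylor2) (bigOD u3 ur)) => h l _.
by field.
Qed.

Lemma bigO_cay_inv : bigO D y one.
Proof.
exists 1 => // h l [_ _ /(cay_inv_bounds h)[y0 y1 _] _].
by rewrite mulr1 ger0_norm ?(ltW y0).
Qed.

Lemma bigO_1Bcay_inv : bigO D (fun h l => 1 - y h l) (fun h l => x h l ^+ 2).
Proof.
exists 1 => // h l [_ _ /(cay_inv_bounds h)[y0 y1 y2] _].
have := sqr_ge0 (h * l) => x2.
by rewrite ger0_norm; lra.
Qed.

Lemma bigO_defect : bigO D (fun h _ => q h) one.
Proof.
exists 1 => // h l [h0 h2 l1 hq]; rewrite mulr1 ger0_norm /defect.
  by have := sqr_ge0 h; lra.
by apply: (le_trans _ hq); apply: ltW.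
Qed.

Lemma bigO_1Bdefect : bigO D (fun h _ => 1 - q h) (fun h _ => h ^+ 2).
Proof.
exists 1 => // h l _; rewrite /defect opprB addrC subrK mul1r.
by have := sqr_ge0 h => h2; rewrite ger0_norm; lra.
Qed.

Lemma defect_gt0 h l : D h l -> 0 < q h.
Proof. by move=> [_ _ _]; apply: lt_le_trans. Qed.

Lemma defect_le1 (h : R) : q h <= 1.
Proof. by rewrite /defect gerBl divr_ge0// sqr_ge0. Qed.

Lemma bigO_cos : bigO D c one.
Proof.
exists 1 => // h l d; have q0' := defect_gt0 d; have [_ _ l1 _] := d.
rewrite mulr1; apply: (@sum_sqr_le1 R _ 0) => //.
rewrite expr0n addr0 -(cay_cos_sin h l1) lerDl mulr_ge0 ?sqr_ge0//; exact: ltW.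
Qed.

Lemma bigO_1Bcos : bigO D (fun h l => 1 - c h l) (fun h l => x h l ^+ 2).
Proof.
have x1 := bigO_hl.
apply: bigO_ext (_ : bigO D (fun h l => 2^-1 * (x h l * x h l * y h l)) _) => [h l _|].
  by rewrite /c expr2; field.
apply: bigOMl; apply: bigO_bounded_Mr bigO_cay_inv.
by apply: (bigO_le ler01) (bigOM x1 x1) => h l _; rewrite mul1r.
Qed.

Lemma bigO_sin : bigO D s x.
Proof. by apply: bigO_bounded_Mr bigO_cay_inv; apply: bigO_hl. Qed.

(** In [cay_cos^2 + defect * cay_sin^2 = 1] a lower bound on [defect] bounds the
    sine uniformly in the frequency. *)
Lemma sin_sqr_le h l : D h l -> s h l ^+ 2 <= q0^-1.
Proof.
move=> [_ _ l1 hq]; have := cay_cos_sin h l1; have := sqr_ge0 (c h l) => c2 E.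
rewrite -[leRHS]mul1r ler_pdivlMr//; have := sqr_ge0 (s h l) => s2.
by have := ler_wpM2l s2 hq; rewrite mulrC in E; lra.
Qed.

Lemma bigO_sin_bounded : bigO D s one.
Proof.
exists (1 + q0^-1); first by rewrite addr_ge0// invr_ge0 ltW.
move=> h l d; have := sin_sqr_le d; have : 0 < q0^-1 by rewrite invr_gt0.
move=> i0 sq; rewrite mulr1; apply: (@sum_sqr_le1 R _ 0); first lra.
rewrite expr0n addr0; lra.
Qed.

Local Notation D1 := (fun h l => admissible q0 h l /\ h * l <= 1).
Local Notation x2 := (fun h l : R => (h * l) ^+ 2).
Local Notation x3 := (fun h l : R => (h * l) ^+ 3).

Lemma bigO_sub (D' D'' : R -> R -> Prop) f Y : (forall h l, D' h l -> D'' h l) ->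
  bigO D'' f Y -> bigO D' f Y.
Proof. by move=> DD [C C0 hC]; exists C => // h l /DD; apply: hC. Qed.

(** Because [h <= h * l <= 1], any product of three of the small quantities
    [h] and [h * l] is at most [(h * l)^3]. *)
Lemma step_taylor : bigOmx D1
  (fun h l => step_mx gamma h l - mx2 (1 - (h * l) ^+ 2 / 2) (h * l - h * l * (gamma * h / 2))
     (- (h * l - h * l * (gamma * h / 2)))
     (1 - 2 * (gamma * h / 2) + 2 * (gamma * h / 2) ^+ 2 - (h * l) ^+ 2 / 2)) x3.
Proof.
have DD h l : D1 h l -> D h l by case.
have X : bigO D1 x x := bigO_sub DD bigO_hl.
have h1 := bigO_sub DD bigO_h1.
have U := bigO_sub DD bigO_half_damping.
have Y0 := bigO_sub DD bigO_cay_inv.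
have Y1 := bigO_sub DD bigO_1Bcay_inv.
have E0 := bigO_sub DD bigO_damp.
have hx h l : D1 h l -> 0 <= h <= h * l /\ h * l <= 1.
  by move=> [/admissible_bounds[h0 _ _ _ ?] ?]; rewrite (ltW h0).
have X2 : bigO D1 (fun h l => 2^-1 * (x h l * x h l)) x2.
  by apply: bigOMl; apply: (bigO_le ler01) (bigOM X X) => h l _; rewrite mul1r.
have X22 : bigO D1 (fun h l => 2^-1 * (x h l * x h l) * (1 - y h l)) x3.
  apply: (bigO_le ler01) (bigOM X2 Y1) => h l /hx[/andP[h0 hx'] x1].
  rewrite mul1r -exprD -[leRHS]mulr1 [in leLHS]exprSr ler_wpM2l// exprn_ge0//.
  exact: le_trans hx'.
have S1 : bigO D1 (fun h l => e h * s h l - (h * l - h * l * (gamma * h / 2))) x3.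
  have A1 : bigO D1 (fun h l => (e h - 1 + gamma * h / 2) * y h l) x2.
    apply: bigO_bounded_Mr Y0; apply: (bigO_le ler01) (bigO_sub DD bigO_damp_taylor1).
    move=> h l /hx[/andP[h0 hx'] x1]; rewrite mul1r ler_sqr// nnegrE//.
    exact: le_trans hx'.
  have A2 : bigO D1 (fun h l => (1 + - (gamma * h / 2)) * (1 - y h l)) x2.
    apply: bigO_bounded_Ml Y1; apply: bigOD (bigO_cst _ _) (bigON _).
    apply: (bigO_le ler01) U => h l /hx[/andP[_ hx'] x1].
    by rewrite mulr1 (le_trans hx').
  apply: bigO_ext_le (bigOM X (bigOD A1 (bigON A2))) _ => h l _.
  by split; [rewrite /s; ring|rewrite -exprS].
have S2 : bigO D1 (fun h l => e h * q h * s h l - (h * l - h * l * (gamma * h / 2))) x3.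
  have A3 : bigO D1 (fun h l => - (e h * s h l * (1 - q h))) x3.
    have es : bigO D1 (fun h l => e h * s h l) x.
      by apply: bigO_bounded_Ml E0 _; apply: bigO_sub DD bigO_sin.
    apply: bigO_ext_le (bigON (bigOM es (bigO_sub DD bigO_1Bdefect))) _ => h l /hx[/andP[h0 hx'] x1].
    split=> //; rewrite [leRHS]exprS ler_wpM2l ?(le_trans h0 hx')// ler_sqr// nnegrE//.
    exact: le_trans hx'.
  by apply: bigO_ext_le (bigOD S1 A3) _ => h l _; split=> //; ring.
have S3 : bigO D1 (fun h l => e h ^+ 2 * c h l - (1 - 2 * (gamma * h / 2)
    + 2 * (gamma * h / 2) ^+ 2 - (h * l) ^+ 2 / 2)) x3.
  have A1 : bigO D1 (fun h l => e h ^+ 2 - (1 - 2 * (gamma * h / 2)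
      + 2 * (gamma * h / 2) ^+ 2)) x3.
    apply: bigO_ext_le (bigO_sub DD bigO_damp_sqr_taylor2) _ => h l /hx[/andP[h0 hx'] x1].
    by split=> //; rewrite lerXn2r// nnegrE (le_trans h0).
  have A2 : bigO D1 (fun h l => 2^-1 * (x h l * x h l) * (y h l * ((1 - e h) * (1 + e h)))) x3.
    have a1 := bigO_bounded_Mr (bigO_sub DD bigO_1Bdamp) (bigOD (bigO_cst D1 1) E0).
    apply: bigO_ext_le (bigOM X2 (bigO_bounded_Ml Y0 a1)) _ => h l /hx[/andP[h0 hx'] x1].
    by split=> //; rewrite [leRHS]exprSr ler_wpM2l ?sqr_ge0.
  apply: bigO_ext_le (bigOD A1 (bigOD X22 A2)) _ => h l _; split=> //.
  by rewrite /c; field.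
have S0 : bigO D1 (fun h l => c h l - (1 - (h * l) ^+ 2 / 2)) x3.
  by apply: bigO_ext_le X22 _ => h l _; split=> //; rewrite /c; field.
apply: bigOmx_ext (bigOmx_mx2 S0 S1 (bigON S2) S3) => h l _.
by rewrite oppmx2 addmx2; apply: eq_mx2 => //; rewrite opprB opprK addrC.
Qed.

Lemma flow_taylor : bigOmx D1
  (fun h l => expmx (h *: osc_mx gamma l)
   - mx2 (1 - (h * l) ^+ 2 / 2) (h * l - h * l * (gamma * h / 2))
     (- (h * l - h * l * (gamma * h / 2)))
     (1 - 2 * (gamma * h / 2) + 2 * (gamma * h / 2) ^+ 2 - (h * l) ^+ 2 / 2)) x3.
Proof.
exists ((2 * 2)%:R * ((2 + gamma) ^+ 3 * expR (2 + gamma))).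
  by rewrite mulr_ge0// mulr_ge0 ?expR_ge0// exprn_ge0// addr_ge0// ltW.
move=> h l [d x1]; have [h0 _ l1 x0 hx] := admissible_bounds d.
have := gamma_gt0 => g0.
have hK : l1norm (h *: osc_mx gamma l) <= (2 + gamma) * (h * l).
  rewrite l1normZ l1norm_mx2 !mxE/= normr0 !normrN !gtr0_norm ?(lt_le_trans ltr01 l1)//.
  nra.
have := expmx_taylor2 hK.
rewrite (_ : 1%:M + _ + _ = mx2 (1 - (h * l) ^+ 2 / 2) (h * l - h * l * (gamma * h / 2))
     (- (h * l - h * l * (gamma * h / 2)))
     (1 - 2 * (gamma * h / 2) + 2 * (gamma * h / 2) ^+ 2 - (h * l) ^+ 2 / 2)); last first.
  rewrite mx2_1 /osc_mx scalemx2 mulmx2 scalemx2 !addmx2.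
  by apply: eq_mx2; field.
move=> /le_trans; apply; rewrite -[leRHS]mulrA ler_wpM2l// exprMn mulrAC ler_wpM2r ?exprn_ge0 ?(ltW x0)//.
have g2 : 0 <= 2 + gamma by rewrite addr_ge0// ltW.
by rewrite ler_wpM2l ?exprn_ge0// ler_expR ler_piMr.
Qed.

(** The undamped step preserves the form by [cay_cos_sin], and the damping of
    the momentum before and after it can only decrease the form; the
    difference is displayed as a sum of squares. *)
Lemma step_contract k (h l : R) (j : 'I_2) : D h l ->
  q h * (step_mx gamma h l ^+ k) 0 j ^+ 2 + (step_mx gamma h l ^+ k) 1 j ^+ 2 <= 1.
Proof.
move=> d; have qp := defect_gt0 d; have q1 := defect_le1 h; have [h0 _ l1 _] := d.
have [e0 e1 _ _] := damp_bounds gamma_gt0 h0; have cs := cay_cos_sin h l1.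
elim: k => [|k IH].
  rewrite expr0 !mxE; have [->|->] := ord2P j; rewrite /= ?expr1n ?expr0n /=; lra.
rewrite (exprS (step_mx _ _ _)) -mulmxE !mulmx2E [step_mx _ _ _ 0 0]mxE [step_mx _ _ _ 0 1]mxE.
rewrite [step_mx _ _ _ 1 0]mxE [step_mx _ _ _ 1 1]mxE /=.
apply: le_trans IH; set a := (step_mx gamma h l ^+ k) 0 j; set b := (step_mx gamma h l ^+ k) 1 j.
have e2 : 0 <= 1 - e h ^+ 2 by rewrite subr_ge0 exprn_ile1// ltW.
rewrite -subr_ge0.
have -> : q h * a ^+ 2 + b ^+ 2 - (q h * (c h l * a + e h * s h l * b) ^+ 2 +
   (- (e h * q h * s h l) * a + e h ^+ 2 * c h l * b) ^+ 2)
  = (1 - e h ^+ 2) * (- q h * s h l * a + c h l * (e h * b)) ^+ 2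
    + (1 - e h ^+ 2) * b ^+ 2
    + (1 - (c h l ^+ 2 + q h * s h l ^+ 2)) * (q h * a ^+ 2 + (e h * b) ^+ 2) by ring.
by rewrite cs subrr mul0r addr0 addr_ge0// mulr_ge0 ?sqr_ge0.
Qed.

Lemma step_pow_bounded k (h l : R) : D h l ->
  l1norm (step_mx gamma h l ^+ k) <= 4 * q0^-1.
Proof.
move=> d; apply: l1norm_mx2_le => i j.
have := step_contract k j d; set a := (step_mx gamma h l ^+ k) 0 j; set b := (step_mx gamma h l ^+ k) 1 j => ab.
have [_ _ _ hq] := d; have q1 : q0 <= 1 := le_trans hq (defect_le1 h).
have ab' : a ^+ 2 + b ^+ 2 <= q0^-1.
  rewrite -[leRHS]mul1r ler_pdivlMr//; have := sqr_ge0 a; have := sqr_ge0 b => b0 a0.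
  have := ler_wpM2l a0 hq; have := ler_wpM2l b0 q1; lra.
have i1 : 1 <= q0^-1 by rewrite invf_ge1.
by have [->|->] := ord2P i; [apply: sum_sqr_le1 ab'|rewrite addrC in ab'; apply: sum_sqr_le1 ab'].
Qed.

(** Where [h * l <= 1] the Taylor expansions agree; where [h * l > 1] it is
    enough that both matrices are bounded. *)
Lemma step_error : bigOmx D (fun h l => step_mx gamma h l - expmx (h *: osc_mx gamma l)) x3.
Proof.
have [C C0 hC] : bigOmx D1
    (fun h l => step_mx gamma h l - expmx (h *: osc_mx gamma l)) x3.
  apply: bigOmx_ext (bigOmxD step_taylor (bigOmxN flow_taylor)) => h l _.
  by rewrite /= [- (expmx _ - _)]opprB; apply: subrKA.
exists (C + (4 * q0^-1 + 4)) => [|h l d].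
  by rewrite !addr_ge0// mulr_ge0// invr_ge0 ltW.
have [h0 _ l1 x0 hx] := admissible_bounds d.
have i0 : 0 < q0^-1 by rewrite invr_gt0.
have x30 : 0 <= (h * l) ^+ 3 by rewrite exprn_ge0// ltW.
(* the constant [4 * q0^-1 + 4] bounds the two matrices separately *)
have [x1|x1] := lerP (h * l) 1.
  by rewrite (le_trans (hC _ _ (conj d x1)))// ler_wpM2r// lerDl; lra.
rewrite (le_trans (l1normD _ _))// l1normN.
have := step_pow_bounded 1 d; rewrite expr1 => sb.
have fb := osc_flow_bounded l (ltW gamma_gt0) (ltW h0).
have x31 : 1 <= (h * l) ^+ 3 by rewrite exprn_ege1// ltW.
by have := lerD sb fb; nra.
Qed.

End LocalErrorBounds.

(** * Global error of one mode *)

Section ModeError.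
Context {R : realType}.
Variables (gamma q0 : R).
Hypotheses (gamma_gt0 : 0 < gamma) (q0_gt0 : 0 < q0).
Local Notation D := (admissible q0).
Local Notation q := defect.
Local Notation y := cay_inv.
Local Notation c := cay_cos.
Local Notation s := cay_sin.
Local Notation e := (damp gamma).
Local Notation one := (fun _ _ : R => 1 : R).
Local Notation x := (fun h l : R => h * l).

(** A matrix [W] on which the flow acts, through [X |-> F X F^T], as the scalar
    [expR (- (gamma * t))]: an eigenvector of the Lyapunov operator of the
    oscillator. *)
Definition osc_inv (l : R) : 'M[R]_2 := mx2 1 (- (gamma / (2 * l))) (- (gamma / (2 * l))) 1.
Definition swap_mx : 'M[R]_2 := mx2 0 1 1 0.

Lemma osc_inv_lyapunov l : l != 0 ->
  osc_mx gamma l *m osc_inv l + osc_inv l *m (osc_mx gamma l)^T = - gamma *: osc_inv l.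
Proof.
by move=> l0; rewrite /osc_mx /osc_inv trmx2 !mulmx2 addmx2 scalemx2; apply: eq_mx2; field.
Qed.

(** After [c^2 = 1 - q * s^2] is used, each entry is a sum of terms with one of
    three small factors: [1 - e^2 - gamma * h * e], of order [h^3]; [gamma * h]
    times a factor of order [(h * l)^2]; or [1 - q = h^2 / 4] times a factor of
    order [h * l].  None of them reaches [h^3 * l^3]. *)
Lemma step_inv_defect : bigOmx D
  (fun h l => step_mx gamma h l *m osc_inv l *m (step_mx gamma h l)^T - e h ^+ 2 *: osc_inv l)
  (fun h l => h ^+ 3 * l ^+ 2).
Proof.
have E0 := @bigO_damp R gamma q0 gamma_gt0.
have Q0 := @bigO_defect R q0 q0_gt0.
have C0 := @bigO_cos R q0 q0_gt0.
have S0 := @bigO_sin_bounded R q0 q0_gt0.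
have S1 := @bigO_sin R q0.
have Y0 := @bigO_cay_inv R q0.
have hx h l : D h l -> [/\ 0 <= h, h <= h * l & h <= 2].
  by move=> /admissible_bounds[/ltW h0 /ltW h2 _ _ ?].
have sinhT f : bigO D f one -> bigO D (fun h l => (1 - e h ^+ 2 - gamma * h * e h) * f h l)
    (fun h l => h ^+ 3 * l ^+ 2).
  move=> hf; apply: bigO_ext_le (bigO_bounded_Mr (@bigO_damp_sinh R gamma q0 gamma_gt0) hf) _ => h l d.
  have [_ _ l1 _] := d; have [h0 _ _] := hx _ _ d.
  by split=> //; rewrite ler_peMr ?exprn_ge0 ?exprn_ege1.
have SS : bigO D (fun h l => s h l * s h l) (fun h l => x h l ^+ 2).
  by apply: bigO_ext_le (bigOM S1 S1) _ => h l _; rewrite expr2.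
have X2 : bigO D (fun h l => s h l * s h l - (1 - y h l) - y h l * (1 - c h l)) (fun h l => x h l ^+ 2).
  apply: bigOD (bigON (bigO_bounded_Ml Y0 (bigO_1Bcos q0))); apply: bigOD SS (bigON (bigO_1Bcay_inv q0)).
have Q1 : bigO D (fun h l => 1 - q h) (fun h l => h ^+ 2) by exact: bigO_1Bdefect.
have Q1x : bigO D (fun h l => 1 - q h) (fun h l => x h l ^+ 2).
  apply: bigO_ext_le Q1 _ => h l /hx[h0 h1 _]; split=> //.
  by rewrite ler_sqr// nnegrE// (le_trans h0).
have ux f : bigO D f (fun h l => x h l ^+ 2) ->
    bigO D (fun h l => gamma * h * e h * f h l) (fun h l => h ^+ 3 * l ^+ 2).
  move=> hf; have gh : bigO D (fun h l => gamma * h * e h) (fun h _ => h).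
    by apply: bigO_bounded_Mr E0; apply: bigOMl; apply: bigO_h.
  apply: bigO_ext_le (bigOM gh hf) _ => h l _; split=> //.
  by rewrite exprMn mulrA -exprS.
have Qs f : bigO D f (fun h l => x h l) ->
    bigO D (fun h l => (1 - q h) * f h l) (fun h l => h ^+ 3 * l ^+ 2).
  move=> hf; apply: bigO_ext_le (bigOM Q1 hf) _ => h l d; split=> //.
  have [_ _ l1 _] := d; have [h0 _ _] := hx _ _ d.
  by rewrite mulrA -exprSr ler_wpM2l ?exprn_ge0// expr2 ler_peMl// (le_trans ler01).
have B00 : bigO D (fun h l => (1 - e h ^+ 2 - gamma * h * e h) * (1 - s h l * s h l)
   + (- (gamma * h * e h * (s h l * s h l - (1 - y h l) - y h l * (1 - c h l)))
   + (1 - q h) * (s h l * s h l))) (fun h l => h ^+ 3 * l ^+ 2).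
  apply: bigOD (bigOD (bigON (ux _ X2)) (Qs _ _)).
    apply: sinhT; apply: bigOD (bigO_cst _ _) (bigON _).
    exact: bigO_bounded_Ml.
  exact: bigO_bounded_Ml.
have B11 : bigO D (fun h l => e h * e h * (- ((1 - e h ^+ 2 - gamma * h * e h) * (1 - q h * (s h l * s h l)))
   + (gamma * h * e h * (q h * (s h l * s h l) - (1 - y h l) - y h l * (1 - q h) - y h l * q h * (1 - c h l))
   - (1 - q h) * (q h * s h l * s h l)))) (fun h l => h ^+ 3 * l ^+ 2).
  apply: bigO_bounded_Ml; first exact: bigO_bounded_Ml.
  apply: bigOD; last apply: bigOD.
  - apply: bigON; apply: sinhT; apply: bigOD (bigO_cst _ _) (bigON _).
    by apply: bigO_bounded_Ml => //; exact: bigO_bounded_Ml.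
  - apply: ux; apply: bigOD; last by apply: bigON; apply: bigO_bounded_Ml (bigO_1Bcos q0); exact: bigO_bounded_Ml.
    apply: bigOD; last by apply: bigON; apply: bigO_bounded_Ml.
    apply: bigOD; last by apply: bigON; apply: bigO_1Bcay_inv.
    by apply: bigO_bounded_Ml.
  - apply: bigON; apply: Qs; apply: bigO_bounded_Ml => //; exact: bigO_bounded_Ml.
have B01 : bigO D (fun h l => e h * (- ((1 - e h ^+ 2 - gamma * h * e h) * (s h l * c h l))
   + (gamma * h * e h * (s h l * ((1 - c h l) - (1 - y h l) - y h l * (1 - q h)))
   + (1 - q h) * (s h l * c h l)))) (fun h l => h ^+ 3 * l ^+ 2).
  apply: bigO_bounded_Ml => //; apply: bigOD; last apply: bigOD.
  - by apply: bigON; apply: sinhT; apply: bigO_bounded_Ml.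
  - apply: ux; apply: bigO_bounded_Ml => //; apply: bigOD (bigON _); last exact: bigO_bounded_Ml.
    by apply: bigOD (bigO_1Bcos q0) (bigON (bigO_1Bcay_inv q0)).
  - by apply: Qs; apply: bigO_bounded_Mr.
apply: bigOmx_ext (bigOmx_mx2 B00 B01 B01 B11) => h l [_ _ l1 _].
have cs := cay_cos_sin h l1.
have l0 : l != 0 by rewrite gt_eqF// (lt_le_trans ltr01).
have c2 : c h l ^+ 2 = 1 - q h * s h l ^+ 2 by rewrite -cs addrK.
have bs : gamma / (2 * l) * s h l = gamma * h / 2 * y h l by rewrite /s; field.
rewrite /step_mx /osc_inv trmx2 !mulmx2 scalemx2 oppmx2 addmx2.
set b := gamma / (2 * l) in bs *; move: bs c2.
move: (c h l) (s h l) (y h l) (e h) (q h) => C S Y E Q bs c2.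
apply: eq_mx2.
- have -> : (C * 1 + E * S * - b) * C + (C * - b + E * S * 1) * (E * S) - E ^+ 2 * 1
    = C ^+ 2 + E ^+ 2 * S ^+ 2 - 2 * (b * S) * E * C - E ^+ 2 by ring.
  by rewrite c2 bs; field.
- have -> : (C * 1 + E * S * - b) * - (E * Q * S) + (C * - b + E * S * 1) * (E ^+ 2 * C) - E ^+ 2 * - b
    = - E * S * C * (Q - E ^+ 2) + E ^+ 2 * (b * S) * Q * S + b * E ^+ 2 * (1 - C ^+ 2) by ring.
  have -> : b * E ^+ 2 * (1 - C ^+ 2) = E ^+ 2 * (b * S) * Q * S by rewrite c2; ring.
  by rewrite bs; field.
- have -> : (- (E * Q * S) * 1 + E ^+ 2 * C * - b) * C + (- (E * Q * S) * - b + E ^+ 2 * C * 1) * (E * S) - E ^+ 2 * - b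
    = - E * S * C * (Q - E ^+ 2) + E ^+ 2 * (b * S) * Q * S + b * E ^+ 2 * (1 - C ^+ 2) by ring.
  have -> : b * E ^+ 2 * (1 - C ^+ 2) = E ^+ 2 * (b * S) * Q * S by rewrite c2; ring.
  by rewrite bs; field.
- have -> : (- (E * Q * S) * 1 + E ^+ 2 * C * - b) * - (E * Q * S) +
      (- (E * Q * S) * - b + E ^+ 2 * C * 1) * (E ^+ 2 * C) - E ^+ 2 * 1
    = E ^+ 2 * (Q ^+ 2 * S ^+ 2 + 2 * (b * S) * E * Q * C + E ^+ 2 * C ^+ 2 - 1) by ring.
  by rewrite c2 bs; field.
Qed.

(** First order is enough here: this error is multiplied by
    [1 / defect h - 1], which is of order [h^2]. *)
Lemma step_corner_defect : bigOmx D
  (fun h l => step_mx gamma h l *m mx2 1 0 0 0 *m (step_mx gamma h l)^T - 1 *: mx2 1 0 0 0) x.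
Proof.
have E0 := @bigO_damp R gamma q0 gamma_gt0.
have Q0 := @bigO_defect R q0 q0_gt0.
have C0 := @bigO_cos R q0 q0_gt0.
have S0 := @bigO_sin_bounded R q0 q0_gt0.
have S1 := @bigO_sin R q0.
have Q0S := bigO_bounded_Ml Q0 (bigO_bounded_Ml S0 S1); have ES := bigO_bounded_Ml E0 (bigO_bounded_Ml Q0 S1).
have E2 := bigO_bounded_Ml E0 E0; have ESC := bigO_bounded_Mr ES C0.
apply: bigOmx_ext (bigOmx_mx2 (bigON Q0S) (bigON ESC) (bigON ESC)
  (bigO_bounded_Ml E2 (bigO_bounded_Ml Q0 Q0S))) => h l [_ _ l1 _].
have cs := cay_cos_sin h l1.
have c2 : c h l ^+ 2 = 1 - q h * s h l ^+ 2 by rewrite -cs addrK.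
rewrite /step_mx trmx2 !mulmx2 scalemx2 oppmx2 addmx2.
move: c2; move: (c h l) (s h l) (y h l) (e h) (q h) => C S Y E Q c2.
apply: eq_mx2; try ring.
have -> : (C * 1 + E * S * 0) * C + (C * 0 + E * S * 0) * (E * S) - 1 * 1 = C ^+ 2 - 1 by ring.
by rewrite c2; ring.
Qed.

Local Notation F := (fun l t : R => expmx (t *: osc_mx gamma l)).

Lemma mode_propagator_error : exists2 C : R, 0 <= C & forall h l m, D h l ->
  l1norm (step_mx gamma h l ^+ m - F l (m%:R * h)) <= m%:R * (C * (h * l) ^+ 3).
Proof.
have [C C0 hC] := @step_error R gamma q0 gamma_gt0 q0_gt0.
exists (4 * q0^-1 * C * 4); first by rewrite !mulr_ge0// invr_ge0 ltW.
move=> h l m d; have [/ltW h0 _ _ _] := d; rewrite expmx_natmul.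
have sb k := @step_pow_bounded R gamma q0 gamma_gt0 q0_gt0 k h l d.
have fb k : l1norm (F l h ^+ k) <= 4.
  by rewrite -expmx_natmul; apply: osc_flow_bounded; rewrite ?mulr_ge0// ltW.
rewrite (le_trans (pow_error_le m sb fb (hC _ _ d)))// ler_wpM2l//.
by rewrite le_eqVlt; apply/orP; left; apply/eqP; ring.
Qed.

(** The stationary matrix of the step is the identity plus [1 / defect h - 1]
    times the corner matrix, and the identity is
    [osc_inv l + gamma / (2 * l) *: swap_mx].  The three summands are treated by
    [step_inv_defect], by [mode_propagator_error], whose [l^3] is compensated by
    the coefficient [gamma / (2 * l)], and by [step_corner_defect]. *)
Lemma mode_covariance_error : exists2 C : R, 0 <= C & forall h l m, D h l ->
  l1norm ((mx2 (q h)^-1 0 0 1 - step_mx gamma h l ^+ m *m mx2 (q h)^-1 0 0 1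
             *m (step_mx gamma h l ^+ m)^T)
          - (1%:M - F l (m%:R * h) *m (F l (m%:R * h))^T))
  <= m%:R * (C * (h ^+ 3 * l ^+ 2)).
Proof.
have [C1 C1_ge0 hC1] := mode_propagator_error.
have [C2 C2_ge0 hC2] := step_inv_defect.
have [C3 C3_ge0 hC3] := step_corner_defect.
have i0 : 0 < q0^-1 by rewrite invr_gt0.
set k := 4 * q0^-1; have k0 : 0 <= k by rewrite mulr_ge0// ltW.
exists (k * C2 * k + gamma * (C1 * k + 4 * C1) + q0^-1 * (k * C3 * k)).
  by rewrite !(addr_ge0, mulr_ge0)// ltW.
move=> h l m d; have [h0 h2 l1 hq] := d; have qp := @defect_gt0 R q0 q0_gt0 h l d.
have l0 : 0 < l := lt_le_trans ltr01 l1.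
set M := step_mx gamma h l ^+ m; set Ft := F l (m%:R * h).
have sb j := @step_pow_bounded R gamma q0 gamma_gt0 q0_gt0 j h l d.
have fb : l1norm Ft <= 4.
  by apply: osc_flow_bounded; rewrite ?mulr_ge0// ltW.
have [e0 e1 _ _] := damp_bounds gamma_gt0 h0.
pose b := gamma / (2 * l).
have E1 : l1norm (M *m osc_inv l *m M^T - Ft *m osc_inv l *m Ft^T)
    <= m%:R * (k * (C2 * (h ^+ 3 * l ^+ 2)) * k).
  rewrite (expmx_lyapunov _ (osc_inv_lyapunov _)) ?gt_eqF//.
  have -> : expR (- (gamma * (m%:R * h))) = (e h ^+ 2) ^+ m.
    rewrite /damp -!expRM_natl !mulrN; congr (expR (- _)).
    by rewrite [2 * _]mulrC divfK 1?mulrCA ?pnatr_eq0.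
  apply: congr_error_le => //; last exact: hC2.
  by rewrite normrX ger0_norm ?(ltW e0)// exprn_ile1// ltW.
have E2 : l1norm (M *m swap_mx *m M^T - Ft *m swap_mx *m Ft^T)
    <= m%:R * (C1 * (h * l) ^+ 3) * 2 * k + 4 * 2 * (m%:R * (C1 * (h * l) ^+ 3)).
  have sw : l1norm swap_mx <= 2 by rewrite l1norm_mx2 !mxE/= normr0 normr1; lra.
  have -> : M *m swap_mx *m M^T - Ft *m swap_mx *m Ft^T
      = (M - Ft) *m swap_mx *m M^T + Ft *m swap_mx *m (M - Ft)^T.
    rewrite linearB /= mulmxBr !mulmxBl addrA subrK //.
  rewrite (le_trans (l1normD _ _))// lerD//.
    by apply: l1normM_le; [apply: l1normM_le => //; apply: hC1|rewrite l1normT; apply: sb].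
  by apply: l1normM_le; [apply: l1normM_le|rewrite l1normT; apply: hC1].
have E3 : l1norm (M *m mx2 1 0 0 0 *m M^T - 1 *: mx2 1 0 0 0)
    <= m%:R * (k * (C3 * (h * l)) * k).
  rewrite -[X in X *: _](expr1n _ m); apply: congr_error_le => //.
    by rewrite normr1.
  exact: hC3.
have -> : mx2 (q h)^-1 0 0 1 - M *m mx2 (q h)^-1 0 0 1 *m M^T - (1%:M - Ft *m Ft^T)
  = - (((q h)^-1 - 1) *: (M *m mx2 1 0 0 0 *m M^T - 1 *: mx2 1 0 0 0))
    - ((M *m osc_inv l *m M^T - Ft *m osc_inv l *m Ft^T)
       + b *: (M *m swap_mx *m M^T - Ft *m swap_mx *m Ft^T)).
  have -> : mx2 (q h)^-1 0 0 1 = ((q h)^-1 - 1) *: mx2 1 0 0 0 + 1%:M.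
    by rewrite mx2_1 scalemx2 addmx2; apply: eq_mx2; ring.
  (* [osc_inv l] is the identity up to the off-diagonal entries [- b] *)
  have W : osc_inv l + b *: swap_mx = 1%:M.
    by rewrite mx2_1 scalemx2 addmx2 /b; apply: eq_mx2; ring.
  have WE (A : 'M[R]_2) : A *m A^T = A *m osc_inv l *m A^T + b *: (A *m swap_mx *m A^T).
    by rewrite scalemxAl scalemxAr -mulmxDl -mulmxDr W mulmx1.
  rewrite !mulmxDr !mulmxDl mulmx1 !WE -scalemxAr -scalemxAl scale1r.
  set A1 := M *m mx2 1 0 0 0 *m M^T; set A2 := M *m osc_inv l *m M^T; set A3 := M *m swap_mx *m M^T.
  set B2 := Ft *m osc_inv l *m Ft^T; set B3 := Ft *m swap_mx *m Ft^T.
  move: (mx2 1 0 0 0) A1 A2 A3 B2 B3 => N A1 A2 A3 B2 B3.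
  by apply/matrixP => i j; rewrite !mxE; ring.
have T3 : l1norm (- (((q h)^-1 - 1) *: (M *m mx2 1 0 0 0 *m M^T - 1 *: mx2 1 0 0 0)))
    <= m%:R * (q0^-1 * (k * C3 * k) * (h ^+ 3 * l ^+ 2)).
  rewrite l1normN l1normZ.
  have qE : (q h)^-1 - 1 = h ^+ 2 / 4 / q h.
    have -> : h ^+ 2 / 4 = 1 - q h by rewrite /defect subKr.
    by rewrite mulrBl mul1r divff ?gt_eqF.
  have qi : (q h)^-1 <= q0^-1 by rewrite lef_pV2.
  have q1 : `|(q h)^-1 - 1| <= h ^+ 2 * q0^-1.
    rewrite qE ger0_norm; last by rewrite !divr_ge0 ?sqr_ge0// ltW.
    rewrite ler_pM ?divr_ge0 ?sqr_ge0 ?invr_ge0 ?(ltW qp)//.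
    by rewrite ler_pdivrMr// ler_peMr ?sqr_ge0// ler1n.
  rewrite (le_trans (ler_pM _ _ q1 E3)) ?l1norm_ge0//.
  have -> : h ^+ 2 / q0 * (m%:R * (k * (C3 * (h * l)) * k))
    = m%:R * (q0^-1 * (k * C3 * k) * (h ^+ 3 * l)) by rewrite /k; field; rewrite gt_eqF.
  rewrite ler_wpM2l// ler_wpM2l//; first by rewrite !mulr_ge0// ltW.
  by rewrite ler_wpM2l ?exprn_ge0 ?(ltW h0)// expr2 ler_peMr// ltW.
have T2 : l1norm (b *: (M *m swap_mx *m M^T - Ft *m swap_mx *m Ft^T))
    <= m%:R * (gamma * (C1 * k + 4 * C1) * (h ^+ 3 * l ^+ 2)).
  have b0 : 0 <= b by rewrite divr_ge0 ?mulr_ge0// ltW.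
  rewrite l1normZ (ger0_norm b0) (le_trans (ler_wpM2l b0 E2))// le_eqVlt.
  by apply/orP; left; apply/eqP; rewrite /b /k; field; rewrite !gt_eqF.
rewrite (le_trans (l1normD _ _))// [X in _ + X]l1normN.
rewrite (le_trans (lerD T3 (le_trans (l1normD _ _) (lerD E1 T2))))//.
by rewrite le_eqVlt; apply/orP; left; apply/eqP; ring.
Qed.

End ModeError.

(** * Eigenvectors of the discrete Laplacian *)

Section Spectrum.
Context {R : realType}.
Variables (d : nat) (ds : R).
Hypothesis (ds_gt0 : 0 < ds).

Definition angle (j : 'I_d) : R := pi * j.+1%:R / d.+1%:R.
Definition sine_mx : 'M[R]_d := \matrix_(i, j) sin (i.+1%:R * angle j).
Definition freq2 (j : 'I_d) : R := (2 - 2 * cos (angle j)) / ds ^+ 2.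

Lemma angle_itv j : 0 < angle j < pi.
Proof.
rewrite /angle divr_gt0 ?mulr_gt0 ?pi_gt0//= ltr_pdivrMr// ltr_pM2l ?pi_gt0//.
by rewrite ltr_nat ltnS.
Qed.

Lemma sin_natpi k : sin (k%:R * pi) = 0 :> R.
Proof.
elim: k => [|k IH]; first by rewrite mul0r sin0.
by rewrite -natr1 mulrDl mul1r sinDpi IH oppr0.
Qed.

Lemma freq2_gt0 j : 0 < freq2 j.
Proof.
have /andP[a0 api] := angle_itv j.
rewrite divr_gt0 ?exprn_gt0// -[X in X - _]mulr1 -mulrBr mulr_gt0// subr_gt0.
rewrite lt_neqAle cos_le1 andbT -cos0; apply/eqP => /cos_inj.
rewrite !in_itv /= lexx pi_ge0 !ltW// => /(_ isT isT) a00.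
by rewrite a00 ltxx in a0.
Qed.

Lemma freq2_le j : freq2 j <= 4 / ds ^+ 2.
Proof.
rewrite ler_pM2r ?invr_gt0 ?exprn_gt0//.
have := @cos_geN1 R (angle j); lra.
Qed.

Lemma freq2_inj : injective freq2.
Proof.
move=> i j; have ds2 : ds ^+ 2 != 0 by rewrite gt_eqF// exprn_gt0.
move=> /(congr1 (fun x => x * ds ^+ 2)); rewrite !divfK// => E.
have cE : cos (angle i) = cos (angle j) by lra.
have inI k : angle k \in `[0, pi].
  by have /andP[a0 api] := angle_itv k; rewrite in_itv /= !ltW.
have := cos_inj (inI i) (inI j) cE.
rewrite /angle => /(mulIf _); rewrite invr_neq0 ?pnatr_eq0// => /(_ isT).
move=> /(mulfI _); rewrite gt_eqF ?pi_gt0// => /(_ isT) /eqP.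
by rewrite eqr_nat eqSS => /eqP /val_inj.
Qed.

Lemma sum_shift (m : nat) (f : nat -> R) :
  (forall k, (d <= k)%N -> k = m -> f k = 0) ->
  \sum_(k < d) (if m == k :> nat then f k else 0) = f m.
Proof.
move=> f0; rewrite -big_mkcond /=.
under eq_bigl do rewrite eq_sym.
rewrite big_ord1_eq; case: ltnP => // dm.
by rewrite f0.
Qed.

(** [sin ((i + 2) a) + sin (i a) = 2 cos a sin ((i + 1) a)]; the terms that the
    Dirichlet condition suppresses are sines of 0 and of a multiple of [pi]. *)
Lemma laplacian_sine : laplacian d ds *m sine_mx = sine_mx *m diag_mx (\row_j - freq2 j).
Proof.
apply/matrixP => i j; rewrite mul_mx_diag !mxE.
pose f (k : nat) : R := sin (k%:R * angle j).
have fd : f d.+1 = 0.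
  by rewrite /f /angle mulrC divfK ?pnatr_eq0// mulrC sin_natpi.
have E : \sum_(k < d) laplacian d ds i k * sine_mx k j =
    (\sum_(k < d) (if i.+1 == k :> nat then f k.+1 else 0)
     + \sum_(k < d) (if k.+1 == i :> nat then f k.+1 else 0) - 2 * f i.+1) / ds ^+ 2.
  rewrite (_ : f i.+1 = \sum_(k < d) (if i == k :> nat then f k.+1 else 0)); last first.
    by rewrite (sum_shift (f := fun k => f k.+1))// => k dk; have := ltn_ord i => /[swap] <-; rewrite ltnNge dk.
  rewrite mulr_sumr -big_split -sumrB mulr_suml; apply: eq_bigr => k _ /=.
  rewrite !mxE -/(f k.+1) -val_eqE /=; case: eqVneq => [->|ik].
    by rewrite (gtn_eqF (ltnSn k)); field; rewrite gt_eqF.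
  case: eqVneq => [<-|ik1] /=.
    by rewrite (gtn_eqF (ltnW (ltnSn i.+1))); field; rewrite gt_eqF.
  by case: eqVneq => _; field; rewrite gt_eqF.
rewrite E (sum_shift (f := fun k => f k.+1)); last first.
  by move=> k dk ki; rewrite (_ : k = d) ?fd//; apply/eqP; rewrite eqn_leq dk ki ltn_ord.
have -> : \sum_(k < d) (if k.+1 == i :> nat then f k.+1 else 0) = f i.
  case: i {E} => [[|i] hi] /=; first by rewrite big1 ?/f ?mul0r ?sin0.
  under eq_bigr do rewrite eqSS eq_sym.
  rewrite (sum_shift (f := fun k => f k.+1))// => k dk ki.
  by move: hi; rewrite -ki ltnNge leqW.
rewrite /freq2 -/(f i.+1).
have -> : f i.+2 = f i.+1 * cos (angle j) + cos (i.+1%:R * angle j) * sin (angle j).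
  by rewrite /f -natr1 mulrDl mul1r sinD.
have -> : f i = f i.+1 * cos (angle j) - cos (i.+1%:R * angle j) * sin (angle j).
  by rewrite /f -sinB -natr1 mulrDl mul1r addrK.
by field; rewrite gt_eqF.
Qed.

Lemma laplacian_sym : (laplacian d ds)^T = laplacian d ds.
Proof. by apply/matrixP => i j; rewrite !mxE eq_sym orbC. Qed.

(** The Gram matrix of the sine vectors commutes with the diagonal matrix of
    the pairwise distinct eigenvalues, because the Laplacian is symmetric; it is
    therefore diagonal, and normalizing the columns makes them orthonormal. *)
Lemma laplacian_diag : exists U : 'M[R]_d,
  [/\ U^T *m U = 1%:M, U *m U^T = 1%:M &
      laplacian d ds = U *m diag_mx (\row_j - freq2 j) *m U^T].
Proof.
set S := sine_mx; set L := diag_mx _; set G := S^T *m S.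
have GL : G *m L = L *m G.
  have E : S^T *m laplacian d ds *m S = G *m L by rewrite -mulmxA laplacian_sine mulmxA.
  have Gs : G^T = G by rewrite trmx_mul trmxK.
  have <- : (G *m L)^T = G *m L by rewrite -E !trmx_mul trmxK laplacian_sym mulmxA.
  by rewrite trmx_mul tr_diag_mx Gs.
have Goff i j : i != j -> G i j = 0.
  move=> ij; have /matrixP/(_ i j) := GL; rewrite mul_mx_diag mul_diag_mx.
  rewrite [in X in X -> _]mxE [X in _ = X -> _]mxE ![(\row_j _) _ _]mxE => E.
  have /eqP : G i j * (freq2 i - freq2 j) = 0 by lra.
  rewrite mulf_eq0 subr_eq0 => /orP[/eqP//|/eqP/freq2_inj ij'].
  by rewrite ij' eqxx in ij.
have Gpos j : 0 < G j j.
  rewrite mxE; have d0 : (0 < d)%N by case: d j => // -[].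
  rewrite (bigD1 (Ordinal d0))//= ltr_pwDl//.
    by rewrite !mxE -expr2 exprn_gt0// mul1r sin_gt0_pi// angle_itv.
  by apply: sumr_ge0 => i _; rewrite !mxE -expr2 sqr_ge0.
pose N := diag_mx (\row_j (Num.sqrt (G j j))^-1).
pose U := S *m N.
have UU : U^T *m U = 1%:M.
  rewrite trmx_mul tr_diag_mx mulmxA -(mulmxA N) -/G.
  apply/matrixP => i j; rewrite mul_mx_diag mul_diag_mx.
  rewrite [LHS]mxE [X in X * _]mxE ![(\row_j _) _ _]mxE [RHS]mxE.
  have [->|ij] := eqVneq i j; last by rewrite (Goff _ _ ij) mulr0 mul0r.
  rewrite -mulrA mulrCA -invfM -expr2 sqr_sqrtr ?(ltW (Gpos j))// divff// gt_eqF//.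
exists U; split => //; first exact: mulmx1C.
have LU : laplacian d ds *m U = U *m L.
  by rewrite mulmxA laplacian_sine -!mulmxA; congr (_ *m _); rewrite diag_mxC.
by rewrite -LU -mulmxA (mulmx1C UU) mulmx1.
Qed.

End Spectrum.

(** * Matrices that are block diagonal in the modes *)

Section Modes.
Context {R : realType}.
Variables (d : nat) (U : 'M[R]_d).
Hypotheses (UtU : U^T *m U = 1%:M) (UUt : U *m U^T = 1%:M).

(** The positions of all modes come first and their momenta last, so a family
    of 2 x 2 matrices, one per mode, becomes a block matrix with four diagonal
    blocks. *)
Definition modeblock (f : 'I_d -> 'M[R]_2) : 'M[R]_(d + d) :=
  block_mx (diag_mx (\row_j f j 0 0)) (diag_mx (\row_j f j 0 1))
           (diag_mx (\row_j f j 1 0)) (diag_mx (\row_j f j 1 1)).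

Definition frame : 'M[R]_(d + d) := block_mx U 0 0 U.

Definition modes (f : 'I_d -> 'M[R]_2) : 'M[R]_(d + d) :=
  frame *m modeblock f *m frame^T.

Lemma frame_trK : frame^T *m frame = 1%:M.
Proof.
rewrite /frame tr_block_mx mulmx_block !trmx0 !mulmx0 !mul0mx !addr0 !add0r UtU.
by rewrite -scalar_mx_block.
Qed.

Lemma frameK_tr : frame *m frame^T = 1%:M.
Proof. exact: mulmx1C frame_trK. Qed.

Lemma modeblockM f g : modeblock f *m modeblock g = modeblock (fun j => f j *m g j).
Proof.
rewrite /modeblock mulmx_block !mulmx_diag -!linearD /=.
congr (block_mx (diag_mx _) (diag_mx _) (diag_mx _) (diag_mx _));
  by apply/rowP => j; rewrite [RHS]mxE mulmx2E !mxE.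
Qed.

Lemma modesM f g : modes f *m modes g = modes (fun j => f j *m g j).
Proof.
rewrite /modes -modeblockM !mulmxA; congr (_ *m _ *m _).
by rewrite -[LHS]mulmxA frame_trK mulmx1.
Qed.

Lemma eq_modes f g : f =1 g -> modes f = modes g.
Proof. by move=> /funext ->. Qed.

Lemma modeblock1 : modeblock (fun=> 1%:M) = 1%:M.
Proof.
rewrite /modeblock [RHS]scalar_mx_block -!diag_const_mx.
congr (block_mx (diag_mx _) _ _ (diag_mx _)).
- by apply/rowP => j; rewrite !mxE.
- by apply/matrixP => i j; rewrite !mxE mul0rn.
- by apply/matrixP => i j; rewrite !mxE mul0rn.
- by apply/rowP => j; rewrite !mxE.
Qed.

Lemma modes1 : modes (fun=> 1%:M) = 1%:M.
Proof. by rewrite /modes modeblock1 mulmx1 frameK_tr. Qed.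

Lemma modesX f k : modes f ^+ k = modes (fun j => f j ^+ k).
Proof.
elim: k => [|k IH]; first by rewrite expr0 -[LHS]modes1; apply: eq_modes.
by rewrite exprS IH -mulmxE modesM; apply: eq_modes => j; rewrite exprS.
Qed.

Lemma modeblockT f : (modeblock f)^T = modeblock (fun j => (f j)^T).
Proof.
rewrite /modeblock tr_block_mx !tr_diag_mx.
by congr (block_mx (diag_mx _) (diag_mx _) (diag_mx _) (diag_mx _));
  apply/rowP => j; rewrite !mxE.
Qed.

Lemma modesT f : (modes f)^T = modes (fun j => (f j)^T).
Proof. by rewrite /modes !trmx_mul trmxK modeblockT mulmxA. Qed.

Lemma modeblock_linear a f g :
  modeblock (fun j => a *: f j + g j) = a *: modeblock f + modeblock g.
Proof.
rewrite /modeblock scale_block_mx add_block_mx.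
congr block_mx; apply/matrixP => i j; rewrite !mxE mulrnDl -mulrnAr//.
Qed.

Lemma modes_linear a f g : modes (fun j => a *: f j + g j) = a *: modes f + modes g.
Proof. by rewrite /modes modeblock_linear mulmxDr mulmxDl -scalemxAr -scalemxAl. Qed.

Lemma modesD f g : modes f + modes g = modes (fun j => f j + g j).
Proof.
by rewrite -[modes f]scale1r -modes_linear; apply: eq_modes => j; rewrite scale1r.
Qed.

Lemma modes0 : modes (fun=> 0) = 0.
Proof. apply: (addrI (modes (fun=> 0))); by rewrite modesD !addr0. Qed.

Lemma modesZ a f : a *: modes f = modes (fun j => a *: f j).
Proof.
by rewrite -[LHS]addr0 -modes0 -modes_linear; apply: eq_modes => j; rewrite addr0.
Qed.

Lemma modesB f g : modes f - modes g = modes (fun j => f j - g j).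
Proof.
by rewrite -scaleN1r modesZ modesD; apply: eq_modes => j; rewrite scaleN1r.
Qed.

Lemma cvg_series_ext (u v : nat -> R) (l : R) : (forall k, u k = v k) ->
  series u @ \oo --> l -> series v @ \oo --> l.
Proof. by move=> /funext ->. Qed.

(** The entries of the exponential are limits of series, and [modes] commutes
    with powers. *)
Lemma modes_expmx f : expmx (modes f) = modes (fun j => expmx (f j)).
Proof.
rewrite /modes (expmx_conj _ frameK_tr frame_trK); congr (_ *m _ *m _).
have pw k : modeblock f ^+ k = modeblock (fun j => f j ^+ k).
  elim: k => [|k IH]; first by rewrite expr0 -[LHS]modeblock1; congr modeblock.
  by rewrite exprS IH -mulmxE modeblockM; congr modeblock; apply/funext => j; rewrite exprS.
have key (a b : 'I_2) (i j : 'I_d) :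
    series (fun k => diag_mx (\row_j (f j ^+ k) a b) i j / k`!%:R) @ \oo -->
    diag_mx (\row_j (expmx (f j)) a b) i j.
  rewrite ![diag_mx _ _ _]mxE.
  have [->|ij] := eqVneq i j.
    rewrite mulr1n [X in _ --> X]mxE.
    by under eq_fun do rewrite [diag_mx _ _ _]mxE eqxx mulr1n mxE; apply: cvg_expmx.
  rewrite mulr0n; under eq_fun do rewrite [diag_mx _ _ _]mxE (negbTE ij) mulr0n mul0r.
  rewrite (_ : series _ = fun=> 0); first exact: cvg_cst.
  by apply/funext => n; rewrite /series /= big1.
apply/matrixP => i j.
suff h : series (fun k => (modeblock f ^+ k) i j / k`!%:R) @ \oo -->
    modeblock (fun j => expmx (f j)) i j.
  exact: (cvg_unique _ (@cvg_expmx _ _ (modeblock f) i j) h).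
case: (split_ordP i) => i' ->; case: (split_ordP j) => j' ->.
- rewrite block_mxEul; apply: cvg_series_ext (key 0 0 i' j') => k.
  by rewrite pw block_mxEul.
- rewrite block_mxEur; apply: cvg_series_ext (key 0 1 i' j') => k.
  by rewrite pw block_mxEur.
- rewrite block_mxEdl; apply: cvg_series_ext (key 1 0 i' j') => k.
  by rewrite pw block_mxEdl.
- rewrite block_mxEdr; apply: cvg_series_ext (key 1 1 i' j') => k.
  by rewrite pw block_mxEdr.
Qed.

Lemma modes_block (a b c e : 'I_d -> R) : modes (fun j => mx2 (a j) (b j) (c j) (e j)) =
  block_mx (U *m diag_mx (\row_j a j) *m U^T) (U *m diag_mx (\row_j b j) *m U^T)
           (U *m diag_mx (\row_j c j) *m U^T) (U *m diag_mx (\row_j e j) *m U^T).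
Proof.
rewrite /modes /frame /modeblock tr_block_mx !trmx0 !mulmx_block.
rewrite !mul0mx !mulmx0 !addr0 !add0r.
by congr block_mx; congr (_ *m diag_mx _ *m _); apply/rowP => j; rewrite !mxE.
Qed.

Lemma diag_cst (a : R) : U *m diag_mx (\row_(j < d) a) *m U^T = a%:M.
Proof.
rewrite (_ : \row_(j < d) a = const_mx a); last by apply/rowP => j; rewrite !mxE.
by rewrite diag_const_mx mul_mx_scalar -scalemxAl UUt scalemx1.
Qed.

Lemma frobeniusE {p q} (A : 'M[R]_(p, q)) : frobenius A ^+ 2 = \tr (A *m A^T).
Proof.
rewrite sqr_sqrtr; last by apply: sumr_ge0 => i _; apply: sumr_ge0 => j _; apply: sqr_ge0.
apply: eq_bigr => i _; rewrite mxE; apply: eq_bigr => j _.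
by rewrite mxE expr2.
Qed.

(** The Frobenius norm is invariant under the orthogonal change of basis
    [frame]. *)
Lemma frobenius_modes_le f (B : R) : 0 <= B -> (forall j, l1norm (f j) <= B) ->
  frobenius (modes f) <= d%:R * B.
Proof.
move=> B0 hB; rewrite -ler_sqr ?nnegrE ?sqrtr_ge0 ?mulr_ge0// frobeniusE.
rewrite modesT modesM /modes -mulmxA mxtrace_mulC -mulmxA frame_trK mulmx1.
rewrite mxtrace_block !mxtrace_diag -big_split /=.
apply: (@le_trans _ _ (\sum_(j < d) B ^+ 2)).
  apply: ler_sum => j _; rewrite ![(\row_j _) _ _]mxE !mulmx2E ![(_^T) _ _]mxE.
  have := hB j; rewrite l1norm_mx2.
  move: (f j 0 0) (f j 0 1) (f j 1 0) (f j 1 1) => a b c e h.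
  apply: (@le_trans _ _ ((`|a| + `|b| + `|c| + `|e|) ^+ 2)); last first.
    by rewrite ler_sqr ?nnegrE ?addr_ge0.
  have sq (v : R) : v * v = `|v| * `|v| by rewrite -!expr2 real_normK ?num_real.
  rewrite (sq a) (sq b) (sq c) (sq e).
  have := normr_ge0 a; have := normr_ge0 b; have := normr_ge0 c; have := normr_ge0 e.
  move: `|a| `|b| `|c| `|e| => x y z t t0 z0 y0 x0.
  rewrite -subr_ge0 (_ : _ - _ = 2 * (x * y + x * z + x * t + y * z + y * t + z * t)); last by ring.
  by rewrite !(mulr_ge0, addr_ge0).
rewrite sumr_const card_ord -[_ *+ d]mulr_natl exprMn ler_wpM2r ?sqr_ge0//.
case: d => [|k]; first by rewrite mulr0n expr0n.
by rewrite expr2 ler_peMr// ler1n.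
Qed.

End Modes.

(** * Modal form of the scheme and of the exact dynamics *)

Section SchemeModes.
Context {R : realType}.
Variables (d : nat) (ds gamma : R) (U : 'M[R]_d) (w : 'I_d -> R).
Hypotheses (ds_gt0 : 0 < ds) (gamma_gt0 : 0 < gamma).
Hypotheses (UtU : U^T *m U = 1%:M) (UUt : U *m U^T = 1%:M).
Hypothesis w_gt0 : forall j, 0 < w j.
Hypothesis lapE : laplacian d ds = U *m diag_mx (\row_j - w j) *m U^T.
Local Notation modes := (modes U).

(** With [1 + w j], rather than [w j], the force [- u] that the scheme treats
    as a kick belongs to the oscillator. *)
Definition lam j := Num.sqrt (1 + w j).
(** The position is multiplied by the frequency, which turns the ellipses of
    constant energy into circles. *)
Definition toscale j : 'M[R]_2 := mx2 (lam j) 0 0 1.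
Definition unscale j : 'M[R]_2 := mx2 (lam j)^-1 0 0 1.

Lemma lam_sqr j : lam j ^+ 2 = 1 + w j.
Proof. by rewrite sqr_sqrtr// addr_ge0// ltW. Qed.

Lemma lam_ge1 j : 1 <= lam j.
Proof. by rewrite -sqrtr1 ler_sqrt ?ler01 ?lerDl ?ltW// addr_gt0. Qed.

Lemma lam_neq0 j : lam j != 0.
Proof. by rewrite gt_eqF// (lt_le_trans ltr01 (lam_ge1 j)). Qed.

Lemma unscaleK j : unscale j *m toscale j = 1%:M.
Proof.
have l0 := lam_neq0 j.
by rewrite mulmx2 mx2_1; apply: eq_mx2; field.
Qed.

Lemma toscaleK j : toscale j *m unscale j = 1%:M.
Proof. exact: mulmx1C (unscaleK j). Qed.

Lemma AmxE : Amx d ds = modes (fun j => mx2 0 1 (- w j) 0).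
Proof. by rewrite modes_block !(diag_cst UUt) -lapE raddf0. Qed.

Lemma BmxE : Bmx d = modes (fun j => mx2 0 0 (- 1) 0).
Proof. by rewrite modes_block !(diag_cst UUt) raddf0 raddfN. Qed.

Lemma PmxE : Pmx d = modes (fun j => mx2 0 0 0 1).
Proof. by rewrite modes_block !(diag_cst UUt) raddf0. Qed.

Lemma OmxE dt : Omx d gamma dt = modes (fun j => mx2 1 0 0 (damp gamma dt)).
Proof. by rewrite modes_block !(diag_cst UUt) raddf0. Qed.

Lemma KmxE : Kmx d ds gamma
  = modes (fun j => unscale j *m osc_mx gamma (lam j) *m toscale j).
Proof.
have -> : Kmx d ds gamma = Amx d ds + Bmx d - gamma *: Pmx d.
  rewrite /Kmx /Amx /Bmx /Pmx scale_block_mx opp_block_mx !add_block_mx.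
  by rewrite !scaler0 !oppr0 !addr0 add0r scalemx1.
rewrite AmxE BmxE PmxE modesZ modesD modesB; apply: eq_modes => j.
have l0 := lam_neq0 j; have l2 := lam_sqr j.
rewrite /unscale /osc_mx /toscale !mulmx2 scalemx2 oppmx2 !addmx2.
apply: eq_mx2; try by field.
have -> : w j = lam j ^+ 2 - 1 by rewrite l2; ring.
by ring.
Qed.

Lemma PhiE t : Phi d ds gamma t
  = modes (fun j => unscale j *m expmx (t *: osc_mx gamma (lam j)) *m toscale j).
Proof.
rewrite /Phi KmxE modesZ (modes_expmx UtU); apply: eq_modes => j.
rewrite -(expmx_conj _ (unscaleK j) (toscaleK j)); congr expmx.
by rewrite -scalemxAr -scalemxAl.
Qed.

Lemma expmx_nilpotent p (X : 'M[R]_p) : X *m X = 0 -> expmx X = 1%:M + X.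
Proof.
move=> X0; apply/matrixP => i j.
have h : series (fun k => (X ^+ k) i j / k`!%:R) @ \oo --> (1%:M + X) i j.
  rewrite -(cvg_shiftn 2) /= (_ : (fun n => _) = fun=> (1%:M + X) i j); first exact: cvg_cst.
  apply/funext => n; rewrite /series /= addn2 big_mkord !big_ord_recl big1; last first.
    move=> k _ /=; rewrite (_ : bump 0 (bump 0 k) = k.+2)// exprS exprS mulrA.
    by rewrite -!mulmxE X0 mul0mx mxE mul0r.
  by rewrite /= expr0 fact0 divr1 addr0 [RHS]mxE expr1 divr1.
exact: (cvg_unique _ (@cvg_expmx _ _ X i j) h).
Qed.

Lemma cayE dt : 0 < dt ->
  cay (dt *: Amx d ds) = modes (fun j =>
    let a := dt ^+ 2 * w j / 4 in
    (1 + a)^-1 *: mx2 (1 - a) dt (- (dt * w j)) (1 - a)).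
Proof.
move=> dt0; pose a j := dt ^+ 2 * w j / 4.
have a0 j : 1 + a j != 0.
  by rewrite gt_eqF// addr_gt0// divr_gt0// mulr_gt0// exprn_gt0.
have b0 j : 4 + dt ^+ 2 * w j != 0.
  by rewrite gt_eqF// addr_gt0// mulr_gt0// exprn_gt0.
have half : 2^-1 *: (dt *: Amx d ds) = modes (fun j => mx2 0 (dt / 2) (- (dt * w j / 2)) 0).
  rewrite AmxE !modesZ; apply: eq_modes => j; rewrite !scalemx2.
  by apply: eq_mx2; field.
rewrite /cay half -(modes1 UtU) modesD modesB.
set N := modes (fun j => 1%:M - _); set N' := modes (fun j => 1%:M + _).
pose I := modes (fun j => (1 + a j)^-1 *: mx2 1 (dt / 2) (- (dt * w j / 2)) 1).
(* [I] is the inverse that the definition of [cay] asks for *)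
have NI : N *m I = 1%:M.
  rewrite (modesM UtU) -(modes1 UtU); apply: eq_modes => j.
  rewrite mx2_1 oppmx2 addmx2 scalemx2 mulmx2.
  by have bj := b0 j; rewrite /a; apply: eq_mx2; field.
have /mulmx1_unit[Nu _] := NI.
have -> : invmx N = I by rewrite -[LHS]mulmx1 -NI mulKmx.
rewrite (modesM UtU); apply: eq_modes => j /=.
rewrite mx2_1 addmx2 !scalemx2 mulmx2; have := b0 j => bj; rewrite /a.
by apply: eq_mx2; field.
Qed.

Definition kick_mx (dt : R) : 'M[R]_2 := mx2 1 0 (- (dt / 2)) 1.

Lemma exp_kickE dt : expmx ((2^-1 * dt) *: Bmx d) = modes (fun=> kick_mx dt).
Proof.
rewrite BmxE modesZ (modes_expmx UtU); apply: eq_modes => j.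
rewrite expmx_nilpotent scalemx2; last by rewrite mulmx2; apply: mx2P; rewrite !mxE /=; ring.
by rewrite mx2_1 addmx2; apply: eq_mx2; field.
Qed.

Definition rot_mx (dt l : R) : 'M[R]_2 :=
  mx2 (cay_cos dt l) (cay_sin dt l) (- (defect dt * cay_sin dt l)) (cay_cos dt l).

(** In the rescaled variables each mode is turned along the level curves of
    [defect dt * x^2 + y^2]. *)
Lemma CmxE dt : 0 < dt -> Cmx d ds dt
  = modes (fun j => unscale j *m rot_mx dt (lam j) *m toscale j).
Proof.
move=> dt0; rewrite /Cmx (cayE dt0) exp_kickE !(modesM UtU); apply: eq_modes => j /=.
have l0 := lam_neq0 j; have l2 := lam_sqr j.
have wE : w j = lam j ^+ 2 - 1 by rewrite l2; ring.
have a0 : 4 + dt ^+ 2 * w j != 0.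
  by rewrite gt_eqF// addr_gt0// mulr_gt0// exprn_gt0.
rewrite /kick_mx scalemx2 /unscale /rot_mx /toscale !mulmx2 /cay_cos /cay_sin /cay_inv /defect.
have a1 : 4 + ((dt * lam j) ^+ 2 - dt ^+ 2) != 0.
  by rewrite (_ : _ - _ = dt ^+ 2 * w j)// wE; ring.
by rewrite wE; apply: eq_mx2; field; rewrite a1 ?l0.
Qed.

Lemma OCOE dt : 0 < dt ->
  Omx d gamma dt *m Cmx d ds dt *m Omx d gamma dt
  = modes (fun j => unscale j *m step_mx gamma dt (lam j) *m toscale j).
Proof.
move=> dt0; rewrite (CmxE dt0) OmxE !(modesM UtU); apply: eq_modes => j.
have l0 := lam_neq0 j.
rewrite /unscale /rot_mx /toscale /step_mx !mulmx2.
by apply: eq_mx2; field.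
Qed.

Lemma KmxE_unscaled : Kmx d ds gamma = modes (fun j => mx2 0 1 (- lam j ^+ 2) (- gamma)).
Proof.
rewrite KmxE; apply: eq_modes => j; have l0 := lam_neq0 j.
by rewrite /unscale /osc_mx /toscale !mulmx2; apply: eq_mx2; field.
Qed.

(** Between the modes [i] and [j] the equation is a linear system in four
    numbers; eliminating three of them shows that the position entry vanishes
    after multiplication by a positive number. *)
Lemma lyapunov_unique (X : 'M[R]_(d + d)) :
  Kmx d ds gamma *m X + X *m (Kmx d ds gamma)^T = 0 -> X = 0.
Proof.
set k := fun j => mx2 0 1 (- lam j ^+ 2) (- gamma).
have FtF := frame_trK UtU; have FFt := frameK_tr UtU.
pose Y := (frame U)^T *m X *m frame U.
have XE : X = frame U *m Y *m (frame U)^T.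
  by rewrite /Y !mulmxA FFt mul1mx -mulmxA FFt mulmx1.
move=> E; suff Y0 : Y = 0 by rewrite XE Y0 mulmx0 mul0mx.
have {}E : modeblock k *m Y + Y *m (modeblock k)^T = 0.
  have := congr1 (fun Z => (frame U)^T *m Z *m frame U) E.
  rewrite mulmx0 mul0mx KmxE_unscaled /Y => <-; rewrite /modes -/k !trmx_mul trmxK.
  rewrite mulmxDr mulmxDl !mulmxA FtF mul1mx.
  by rewrite -[in X in _ = _ + X](mulmxA _ _ (frame U)) FtF mulmx1.
have lpos j : 0 < lam j ^+ 2 by rewrite exprn_gt0// (lt_le_trans ltr01 (lam_ge1 j)).
move: E; rewrite modeblockT -[Y]submxK /modeblock.
set a := ulsubmx Y; set b := ursubmx Y; set c := dlsubmx Y; set e := drsubmx Y.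
rewrite !mulmx_block add_block_mx -[RHS]submxK => /eq_block_mx[E1 E2 E3 E4].
have key i j : [/\ a i j = 0, b i j = 0, c i j = 0 & e i j = 0].
  have := (congr1 (fun Z : 'M[R]_d => Z i j) E4, congr1 (fun Z : 'M[R]_d => Z i j) E3,
    congr1 (fun Z : 'M[R]_d => Z i j) E2, congr1 (fun Z : 'M[R]_d => Z i j) E1).
  rewrite !mul_mx_diag !mul_diag_mx; clearbody a b c e; rewrite /k !mxE /=.
  move: (lam i ^+ 2) (lam j ^+ 2) (lpos i) (lpos j) => l m l0 m0.
  move: (a i j) (b i j) (c i j) (e i j) => A B C E [[[F4 F3] F2] F1].
  have CB : C = - B by lra.
  have BE : 2 * gamma * B = (l - m) * A by rewrite CB in F3; lra.
  have EE : 2 * gamma * E = (m - l) * B by rewrite CB in F4; lra.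
  have EA : 2 * E = (l + m) * A by rewrite CB in F3; lra.
  have /eqP : A * (2 * gamma ^+ 2 * (l + m) + (l - m) ^+ 2) = 0.
    have -> : A * (2 * gamma ^+ 2 * (l + m) + (l - m) ^+ 2)
      = 2 * gamma ^+ 2 * ((l + m) * A) + (l - m) * ((l - m) * A) by ring.
    rewrite -EA -BE.
    have -> : 2 * gamma ^+ 2 * (2 * E) + (l - m) * (2 * gamma * B)
      = 2 * gamma * (2 * gamma * E) + (l - m) * (2 * gamma * B) by ring.
    by rewrite EE; ring.
  rewrite mulf_eq0 => /orP[/eqP A0|]; last first.
    rewrite gt_eqF// ltr_pwDl ?sqr_ge0// mulr_gt0 ?addr_gt0// mulr_gt0// exprn_gt0//.
  have B0 : B = 0.
    by apply/eqP; move/eqP: BE; rewrite A0 mulr0 mulf_eq0 gt_eqF ?mulr_gt0.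
  by split=> //; [rewrite CB B0 oppr0|rewrite A0 in EA; lra].
rewrite -[RHS]submxK; congr block_mx; apply/matrixP => i j;
  by have [ha hb hc he] := key i j; rewrite ?ha ?hb ?hc ?he !mxE.
Qed.

Definition exact_stationary : 'M[R]_(d + d) :=
  ds^-1 *: modes (fun j => unscale j *m (unscale j)^T).
Definition scheme_stationary (dt : R) : 'M[R]_(d + d) :=
  ds^-1 *: modes (fun j => unscale j *m mx2 (defect dt)^-1 0 0 1 *m (unscale j)^T).

Lemma exact_stationary_lyapunov : Kmx d ds gamma *m exact_stationary + exact_stationary *m (Kmx d ds gamma)^T
  = - ((2 * gamma / ds) *: Pmx d).
Proof.
rewrite /exact_stationary KmxE PmxE -scalemxAr -scalemxAl -scalerDr modesT !(modesM UtU) modesD.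
rewrite -scaleNr !modesZ; apply: eq_modes => j; have l0 := lam_neq0 j.
have ds0 : ds != 0 by rewrite gt_eqF.
rewrite /unscale /osc_mx /toscale !trmx2 !mulmx2 !trmx2 !mulmx2 !addmx2 !scalemx2.
by apply: eq_mx2; field; rewrite ?l0 ?ds0.
Qed.

(** Both sides solve the Lyapunov equation, since [Phi] commutes with [Kmx]. *)
Lemma exact_covarianceE t G : is_exact_covariance ds gamma t G ->
  G = exact_stationary - Phi d ds gamma t *m exact_stationary *m (Phi d ds gamma t)^T.
Proof.
rewrite /is_exact_covariance => GE; apply/eqP; rewrite -subr_eq0; apply/eqP.
apply: lyapunov_unique; set K := Kmx d ds gamma in GE *; set F := Phi d ds gamma t in GE *.
have KF : K *m F = F *m K by apply: expmx_commZ.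
set H := exact_stationary; have HE := exact_stationary_lyapunov; rewrite -/K -/H in HE.
have -> : K *m (G - (H - F *m H *m F^T)) + (G - (H - F *m H *m F^T)) *m K^T
  = (K *m G + G *m K^T) - (K *m H + H *m K^T) + F *m (K *m H + H *m K^T) *m F^T.
  have FK : F^T *m K^T = K^T *m F^T by rewrite -!trmx_mul KF.
  rewrite !mulmxBr !mulmxBl !mulmxDr !mulmxDl !mulmxA KF -(mulmxA _ F^T) FK !mulmxA.
  by apply/matrixP => i j; rewrite !mxE; ring.
rewrite GE HE mulmxN mulNmx -scalemxAr -scalemxAl scalerBr opprK.
by rewrite subrK subrr.
Qed.

(** The covariance of the noise that one full step adds: that of the first half
    step is carried through [Omx *m Cmx], that of the second half step is not. *)
Definition noise_cov (dt : R) : 'M[R]_(d + d) :=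
  (ds^-1 * (1 - damp gamma dt ^+ 2)) *:
    (Omx d gamma dt *m Cmx d ds dt *m Pmx d *m (Omx d gamma dt *m Cmx d ds dt)^T + Pmx d).

(** The rotation preserves this covariance by [cay_cos_sin], and each half step
    of the friction replaces the momentum variance 1 by
    [damp^2 + (1 - damp^2) = 1]. *)
Lemma scheme_stationary_step dt : 0 < dt -> dt < 2 ->
  let M := Omx d gamma dt *m Cmx d ds dt *m Omx d gamma dt in
  M *m scheme_stationary dt *m M^T + noise_cov dt = scheme_stationary dt.
Proof.
move=> dt0 dt2 M; rewrite /M (OCOE dt0) /noise_cov (CmxE dt0) OmxE PmxE /scheme_stationary.
rewrite !(modesM UtU) !modesT -scalemxAr -scalemxAl !(modesM UtU) !modesD !modesZ !modesD.
apply: eq_modes => j; have l0 := lam_neq0 j; have ds0 : ds != 0 by rewrite gt_eqF.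
have q0 : defect dt != 0 by rewrite /defect gt_eqF//; nra.
have cs := cay_cos_sin dt (lam_ge1 j).
rewrite /unscale /rot_mx /toscale /step_mx.
move: (damp gamma dt) (cay_cos dt (lam j)) (cay_sin dt (lam j)) cs => e c s cs.
move: (defect dt) q0 cs => q q0 cs.
have c2 : c ^+ 2 = 1 - q * s ^+ 2 by rewrite -cs addrK.
rewrite !trmx2 !mulmx2 !trmx2 !mulmx2 !addmx2 !scalemx2 !addmx2.
apply: eq_mx2.
- transitivity (ds^-1 * (lam j)^-1 ^+ 2 * q^-1 * (c ^+ 2 + q * s ^+ 2)).
    by field; rewrite ?l0 ?ds0 ?q0.
  by rewrite cs; field; rewrite ?l0 ?ds0 ?q0.
- by field; rewrite ?l0 ?ds0 ?q0.
- by field; rewrite ?l0 ?ds0 ?q0.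
- transitivity (ds^-1 * (e ^+ 2 * (c ^+ 2 + q * s ^+ 2) + (1 - e ^+ 2))).
    by field; rewrite ?l0 ?ds0 ?q0.
  by rewrite cs; field; rewrite ?l0 ?ds0 ?q0.
Qed.

Lemma l1norm_unscale j : l1norm (unscale j) <= 2.
Proof.
rewrite l1norm_mx2 !mxE /= normr0 normr1 ger0_norm ?invr_ge0 ?sqrtr_ge0//.
have l1 := lam_ge1 j; have l0 : 0 < lam j := lt_le_trans ltr01 l1.
by have : (lam j)^-1 <= 1; [rewrite invf_le1|lra].
Qed.

Lemma l1norm_toscale j : l1norm (toscale j) <= 2 * lam j.
Proof.
rewrite l1norm_mx2 !mxE /= normr0 normr1 ger0_norm ?sqrtr_ge0//.
by have := lam_ge1 j; lra.
Qed.

Lemma frobeniusZ {p q} (a : R) (A : 'M[R]_(p, q)) : 0 <= a ->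
  frobenius (a *: A) = a * frobenius A.
Proof.
move=> a0; rewrite /frobenius -[X in X * _]ger0_norm// -sqrtr_sqr -sqrtrM ?sqr_ge0//.
congr Num.sqrt; rewrite mulr_sumr; apply: eq_bigr => i _; rewrite mulr_sumr.
by apply: eq_bigr => j _; rewrite mxE exprMn.
Qed.

End SchemeModes.

(** * Global errors in all modes *)

Section GlobalError.
Context {R : realType}.
Variables (gamma q0 : R).
Hypotheses (gamma_gt0 : 0 < gamma) (q0_gt0 : 0 < q0).

Lemma lam_freq2_sqr_le d (ds : R) (j : 'I_d) : 0 < ds ->
  lam (freq2 ds) j ^+ 2 <= 1 + 4 / ds ^+ 2.
Proof.
move=> ds0; rewrite (lam_sqr (freq2_gt0 ds0)) lerD2l; exact: freq2_le.
Qed.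

(** Passing from the rescaled variables back to the original ones multiplies
    the error [lam^3] of a mode by another [lam], and [lam^4] is at most
    [(1 + 4 / ds^2)^2]. *)
Lemma propagator_error : exists2 C : R, 0 <= C & forall d (ds dt : R) m,
  0 < ds -> 0 < dt -> dt < 2 -> q0 <= defect dt ->
  frobenius ((Omx d gamma dt *m Cmx d ds dt *m Omx d gamma dt) ^+ m
             - Phi d ds gamma (m%:R * dt))
  <= d%:R * (m%:R * (C * dt ^+ 3 * (1 + 4 / ds ^+ 2) ^+ 2)).
Proof.
have [C C0 hC] := mode_propagator_error gamma_gt0 q0_gt0.
exists (4 * C) => [|d ds dt m ds0 dt0 dt2 hq]; first by rewrite mulr_ge0.
have [U [UtU UUt lapE]] := laplacian_diag d ds0.
have w0 := @freq2_gt0 R d ds ds0.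
rewrite (OCOE gamma UtU UUt w0 lapE dt0) (PhiE gamma UtU UUt w0 lapE) (modesX UtU) modesB.
set B := 1 + 4 / ds ^+ 2.
have B0 : 0 <= B by rewrite addr_ge0// divr_ge0// sqr_ge0.
have bound0 : 0 <= m%:R * (4 * C * dt ^+ 3 * B ^+ 2).
  by rewrite !mulr_ge0// ?exprn_ge0// ltW.
apply: (frobenius_modes_le UtU bound0) => j.
have l1 := lam_ge1 w0 j; set l := lam _ _ in l1 *.
have l0 : 0 <= l by rewrite (le_trans ler01).
have -> : (unscale (freq2 ds) j *m step_mx gamma dt l *m toscale (freq2 ds) j) ^+ m
    = unscale (freq2 ds) j *m step_mx gamma dt l ^+ m *m toscale (freq2 ds) j.
  elim: m {bound0} => [|m IH]; first by rewrite !expr0 mulmx1 (unscaleK w0).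
  rewrite !exprSr IH -!mulmxE !mulmxA; congr (_ *m _ *m _).
  by rewrite -[LHS]mulmxA (toscaleK w0) mulmx1.
rewrite -mulmxBl -mulmxBr.
have adm : admissible q0 dt l by split.
have := l1normM_le (l1normM_le (l1norm_unscale w0 j) (hC _ _ m adm)) (l1norm_toscale w0 j).
move=> /le_trans; apply.
have -> : 2 * (m%:R * (C * (dt * l) ^+ 3)) * (2 * l)
  = m%:R * (4 * C * dt ^+ 3 * (l ^+ 2) ^+ 2) by ring.
rewrite ler_wpM2l// ler_wpM2l//; first by rewrite mulr_ge0 ?exprn_ge0 ?mulr_ge0 ?(ltW dt0).
by rewrite lerXn2r ?nnegrE ?sqr_ge0//; apply: lam_freq2_sqr_le.
Qed.

(** The matrix [H] is the stationary covariance of the scheme, which enters the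
    covariance of the process through its fixed-point equation only.  A
    covariance is rescaled by [unscale] on both sides, which is bounded, so that
    no power of the frequency is lost. *)
Lemma covariance_error : exists2 C : R, 0 <= C & forall d (ds dt : R) m G,
  0 < ds -> 0 < dt -> dt < 2 -> q0 <= defect dt ->
  is_exact_covariance ds gamma (m%:R * dt) G ->
  exists2 H : 'M[R]_(d + d),
   let M := Omx d gamma dt *m Cmx d ds dt *m Omx d gamma dt in
   M *m H *m M^T + noise_cov d ds gamma dt = H &
   let M := Omx d gamma dt *m Cmx d ds dt *m Omx d gamma dt in
   frobenius (H - M ^+ m *m H *m (M ^+ m)^T - G)
   <= ds^-1 * (d%:R * (m%:R * (C * dt ^+ 3 * (1 + 4 / ds ^+ 2)))).
Proof.
have [C C0 hC] := mode_covariance_error gamma_gt0 q0_gt0.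
exists (4 * C) => [|d ds dt m G ds0 dt0 dt2 hq GE]; first by rewrite mulr_ge0.
have [U [UtU UUt lapE]] := laplacian_diag d ds0.
have w0 := @freq2_gt0 R d ds ds0.
exists (scheme_stationary ds U (freq2 ds) dt); first exact: (scheme_stationary_step gamma ds0 UtU UUt w0 lapE dt0 dt2).
rewrite /= (exact_covarianceE ds0 gamma_gt0 UtU UUt w0 lapE GE).
rewrite (OCOE gamma UtU UUt w0 lapE dt0) (PhiE gamma UtU UUt w0 lapE) (modesX UtU).
set B := 1 + 4 / ds ^+ 2.
have B0 : 0 <= B by rewrite addr_ge0// divr_ge0// sqr_ge0.
have bound0 : 0 <= m%:R * (4 * C * dt ^+ 3 * B).
  by rewrite !mulr_ge0// ?exprn_ge0// ltW.
rewrite /scheme_stationary /exact_stationary !modesT -!scalemxAr -!scalemxAl !(modesM UtU) -!scalerBr !modesB.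
rewrite frobeniusZ ?invr_ge0 ?(ltW ds0)// ler_wpM2l ?invr_ge0 ?(ltW ds0)//.
apply: (frobenius_modes_le UtU bound0) => j.
have l1 := lam_ge1 w0 j; set l := lam _ _ in l1 *.
have l0 : 0 <= l by rewrite (le_trans ler01).
set u := unscale _ j; set v := toscale _ j.
have uv : u *m v = 1%:M by apply: unscaleK.
have vu : v *m u = 1%:M by apply: toscaleK.
have -> : (u *m step_mx gamma dt l *m v) ^+ m = u *m step_mx gamma dt l ^+ m *m v.
  elim: m {bound0 GE} => [|m IH]; first by rewrite !expr0 mulmx1 uv.
  rewrite !exprSr IH -!mulmxE !mulmxA; congr (_ *m _ *m _).
  by rewrite -[LHS]mulmxA vu mulmx1.
have adm : admissible q0 dt l by split.
set q := mx2 _ 0 0 1; set M := _ ^+ m; set F := expmx _.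
have cj (A W : 'M[R]_2) : u *m A *m v *m (u *m W *m u^T) *m (u *m A *m v)^T = u *m (A *m W *m A^T) *m u^T.
  have vu' : u^T *m v^T = 1%:M by rewrite -trmx_mul vu trmx1.
  by rewrite !trmx_mul !mulmxA -(mulmxA (u *m A) v u) vu mulmx1 -(mulmxA _ u^T v^T) vu' mulmx1.
have -> : u *m u^T = u *m 1%:M *m u^T by rewrite mulmx1.
rewrite !cj -!mulmxBl -!mulmxBr mulmx1.
have uT : l1norm u^T <= 2 by rewrite l1normT; apply: l1norm_unscale.
have := l1normM_le (l1normM_le (l1norm_unscale w0 j) (hC _ _ m adm)) uT.
move=> /le_trans; apply.
have -> : 2 * (m%:R * (C * (dt ^+ 3 * l ^+ 2))) * 2 = m%:R * (4 * C * dt ^+ 3 * l ^+ 2) by ring.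
rewrite ler_wpM2l// ler_wpM2l//; first by rewrite mulr_ge0 ?exprn_ge0 ?mulr_ge0 ?(ltW dt0).
exact: lam_freq2_sqr_le.
Qed.

End GlobalError.

(** * The condition on g *)

Section Damping.
Context {R : realType}.

Lemma cosh_gt1 (x : R) : 0 < x -> 1 < cosh x.
Proof.
move=> x0; rewrite /cosh ltr_pdivlMr// expRN.
have e1 : 1 < expR x by rewrite expR_gt1.
have e0 : 0 < expR x := lt_trans ltr01 e1.
rewrite -subr_gt0 (_ : _ - _ = (expR x - 1) ^+ 2 / expR x); last by field; rewrite gt_eqF.
by rewrite divr_gt0// exprn_gt0// subr_gt0.
Qed.

Lemma ler_cosh (x y : R) : 0 <= x -> x <= y -> cosh x <= cosh y.
Proof.
move=> x0 xy; rewrite /cosh ler_pM2r ?invr_gt0// !expRN.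
have ex : 1 <= expR x by rewrite -expR0 ler_expR.
have ey : expR x <= expR y by rewrite ler_expR.
have ex0 : 0 < expR x := lt_le_trans ltr01 ex.
have ey0 : 0 < expR y := lt_le_trans ex0 ey.
rewrite -subr_ge0.
rewrite (_ : _ - _ = (expR y - expR x) * (expR x * expR y - 1) / (expR x * expR y)); last first.
  by field; rewrite !gt_eqF.
rewrite divr_ge0 ?mulr_ge0 ?subr_ge0 ?(ltW ex0) ?(ltW ey0)//.
by rewrite (le_trans ex)// ler_peMr ?(ltW ex0)// (le_trans ex).
Qed.

Lemma cos_theta (dt omega : R) : 0 < dt -> dt < 2 ->
  cos (theta dt omega) = (4 - 2 * dt ^+ 2 - dt ^+ 2 * omega ^+ 2) / (4 + dt ^+ 2 * omega ^+ 2).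
Proof.
move=> dt0 dt2; have d4 : 0 < 4 - dt ^+ 2 by rewrite subr_gt0; nra.
have o1 : 0 < 1 + omega ^+ 2 by rewrite ltr_pwDl ?sqr_ge0.
rewrite /theta mulr_natl cos_mulr2n cos_atan exprVn sqr_sqrtr; last first.
  by rewrite addr_ge0 ?sqr_ge0.
rewrite exprMn expr_div_n !sqr_sqrtr ?(ltW d4) ?(ltW o1)//.
have o2 := sqr_ge0 omega; have dd := sqr_ge0 dt.
by rewrite mulr2n; field; rewrite !gt_eqF//; nra.
Qed.

(** For [dt <= 1] the bound is clear.  Otherwise the hyperbolic cosine in [g] is
    at least [cosh (gamma / 2)], so [0 < g] keeps the cosine away from -1,
    which is the limit of the cosine as [dt] tends to 2, for every [omega]. *)
Lemma defect_ge (gamma dt omega : R) : 0 < gamma -> 0 < dt -> dt < 2 ->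
  0 < g dt omega gamma -> (1 - (cosh (gamma / 2))^-1) / 2 <= defect dt.
Proof.
move=> g0 dt0 dt2; rewrite /g; set k := cosh (gamma / 2).
have k1 : 1 < k by apply: cosh_gt1; rewrite divr_gt0.
have k0 : 0 < k := lt_trans ltr01 k1.
have ki0 : 0 < k^-1 by rewrite invr_gt0.
have kik : k^-1 * k = 1 by rewrite mulVf// gt_eqF.
rewrite /defect => hg; have [h1|h1] := lerP dt 1.
  have : dt ^+ 2 <= 1 by rewrite exprn_ile1// ltW.
  lra.
have kk : k <= cosh (gamma * dt / 2).
  by apply: ler_cosh; [rewrite divr_ge0 ?(ltW g0)|rewrite ler_pM2r ?invr_gt0// ler_peMr ?(ltW g0) ?(ltW h1)].
set c := cos _ in hg.
have ck : c ^+ 2 * k ^+ 2 < 1.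
  rewrite (le_lt_trans (y := c ^+ 2 * cosh (gamma * dt / 2) ^+ 2))//; last by rewrite -subr_gt0.
  by rewrite ler_wpM2l ?sqr_ge0// ler_sqr ?nnegrE ?(ltW k0)// (le_trans (ltW k0)).
have ckN : - 1 < c * k.
  rewrite ltNge; apply/negP => h; rewrite -exprMn in ck; nra.
have E := @cos_theta dt omega dt0 dt2; rewrite -/c in E.
have y0 : 0 <= dt ^+ 2 * omega ^+ 2 by rewrite mulr_ge0 ?sqr_ge0.
have cE : c * (4 + dt ^+ 2 * omega ^+ 2) = 4 - 2 * dt ^+ 2 - dt ^+ 2 * omega ^+ 2.
  by rewrite E divfK// gt_eqF//; lra.
move: y0 cE; move: (dt ^+ 2 * omega ^+ 2) => y y0 cE.
have cki : - k^-1 < c.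
  by rewrite -(@ltr_pM2r _ k)// mulNr kik.
have ki1 : k^-1 < 1 by rewrite invf_lt1.
by nra.
Qed.

End Damping.

(** * Moments of the standard normal law *)

Section NormalMoments.
Context {R : realType}.
Local Open Scope ereal_scope.
Notation mu := (@lebesgue_measure R).
Notation N01 := (@normal_prob R 0%R 1%R).
Notation phi := (@normal_pdf R 0%R 1%R).

(** The normal law is defined by its density, which therefore agrees almost
    everywhere with the Radon-Nikodym derivative. *)
Lemma ge0_integral_normal (f : R -> \bar R) : measurable_fun setT f ->
  (forall x, 0 <= f x) -> \int[N01]_x f x = \int[mu]_x (f x * (phi x)%:E).
Proof.
move=> mf f0; have dom := @normal_prob_dominates R 0%R 1%R.
have mphi : measurable_fun [set: R] (fun x => (phi x)%:E).
  by apply/measurable_EFinP; apply: measurable_normal_pdf.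
rewrite -(Radon_Nikodym_SigmaFinite.change_of_variables dom)//.
have iRN := Radon_Nikodym_SigmaFinite.f_integrable dom.
apply: ge0_ae_eq_integral => //.
- by apply: emeasurable_funM => //; apply: measurable_int iRN.
- by apply: emeasurable_funM.
- by move=> x _; rewrite mule_ge0// Radon_Nikodym_SigmaFinite.f_ge0.
- by move=> x _; rewrite mule_ge0// lee_fin normal_pdf_ge0.
apply: ae_eqe_mul2l; apply: integral_ae_eq => // E _ mE.
by rewrite -(Radon_Nikodym_SigmaFinite.f_integral dom).
Qed.

Lemma normal_pdf01E x : phi x = (normal_peak 1 * expR (- (x ^+ 2 / 2)))%R.
Proof.
rewrite normal_pdfE ?oner_neq0// /normal_fun subr0 expr1n mulNr.
by rewrite -[(1 *+ 2)%R]/(2%R : R).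
Qed.

Lemma normal_pdf_even x : phi (- x)%R = phi x.
Proof. by rewrite !normal_pdf01E sqrrN. Qed.

Lemma continuous_mul_pdf (f : R -> R) : continuous f -> continuous (fun x => f x * phi x)%R.
Proof. by move=> cf x; apply: cvgM; [exact: cf|apply: continuous_normal_pdf; exact: oner_neq0]. Qed.

(** The density is even, so that the substitution [x |-> - x] exchanges the two
    integrals; their difference is the mean. *)
Lemma normal_mean_parts :
  \int[N01]_x (Num.max x 0)%:E = \int[N01]_x (Num.max (- x) 0)%:E.
Proof.
have cmax (f : R -> R) : continuous f -> continuous (fun x => Num.max (f x) 0)%R.
  by move=> cf x; apply: continuous_max; [exact: cf|exact: cvg_cst].
have cid : continuous (fun x : R => x) by move=> x; exact: cvg_id.
have cN : continuous (fun x : R => - x)%R by move=> x; apply: cvgN; exact: cvg_id.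
rewrite !ge0_integral_normal; last 4 first.
- by apply/measurable_EFinP; apply: continuous_measurable_fun; exact: cmax cN.
- by move=> x; rewrite lee_fin le_max lexx orbT.
- by apply/measurable_EFinP; apply: continuous_measurable_fun; exact: cmax cid.
- by move=> x; rewrite lee_fin le_max lexx orbT.
pose G (x : R) : R := (Num.max (- x) 0 * phi x)%R.
have cG : continuous G by apply: continuous_mul_pdf; exact: cmax cN.
have G0 x : (0 <= G x)%R by rewrite mulr_ge0 ?normal_pdf_ge0// le_max lexx orbT.
have -> : \int[mu]_x ((Num.max (- x) 0)%:E * (phi x)%:E)
    = \int[mu]_(x in `]-oo, (- 0)%R]) (G x)%:E.
  rewrite [RHS]integral_mkcond; apply: eq_integral => x _; rewrite patchE.
  case: ifPn => //; rewrite notin_setE/= in_itv/= oppr0 => /negP; rewrite -ltNge => x0.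
  by rewrite (max_r _) ?mul0e// oppr_le0 ltW.
rewrite ge0_integration_by_substitutionNy; last 2 first.
- exact: continuous_subspaceT.
- by move=> x _; exact: G0.
rewrite [RHS]integral_mkcond; apply: eq_integral => x _; rewrite patchE.
rewrite /G /= opprK normal_pdf_even; case: ifPn => //.
rewrite notin_setE/= in_itv/= andbT => /negP; rewrite -ltNge => x0.
by rewrite (max_r _) ?mul0e// ltW.
Qed.

Lemma cvg_mul_gauss : (x * expR (- (x ^+ 2 / 2)))%R @[x --> +oo%R] --> (0 : R)%R.
Proof.
have lim : (expR 2 * expR (- x))%R @[x --> +oo%R] --> (0 : R)%R.
  by rewrite -[X in _ --> X](mulr0 (expR 2)); apply: cvgMl_tmp; exact: cvgr_expR.
apply: (squeeze_cvgr _ (cvg_cst 0%R) lim).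
near=> x; have x0 : (0 < x)%R by near: x; exact: nbhs_pinfty_gt.
rewrite mulr_ge0 ?expR_ge0 ?(ltW x0)//=.
(* [x - x^2 / 2 <= 2 - x] *)
have xe : (x <= expR x)%R by rewrite (le_trans _ (expR_ge1Dx x))// lerDr.
rewrite (le_trans (ler_wpM2r (expR_ge0 _) xe))// -!expRD ler_expR.
by have := sqr_ge0 (x - 2); lra.
Unshelve. all: by end_near. Qed.

Lemma is_derive_gauss (x : R) : is_derive x (1 : R)%R
  (fun x => expR (- (x ^+ 2 / 2)))%R (- x * expR (- (x ^+ 2 / 2)))%R.
Proof.
have d : is_derive x (1 : R)%R (fun x : R => - (x ^+ 2 / 2))%R (- x)%R.
  rewrite (_ : (fun x : R => _) = (- 2^-1 : R) \*: (fun x : R => x ^+ 2))%R; last first.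
    by apply/funext => t; rewrite -[RHS]/(- 2^-1 * t ^+ 2)%R mulNr mulrC.
  apply: is_derive_eq (is_deriveZ _ (is_deriveX 2 (is_derive_id x 1%R))) _.
  transitivity (- 2^-1 * (2 * x * 1))%R; first by [].
  by field.
apply: is_derive_eq (is_derive1_comp (is_derive_expR _) d) _.
by rewrite mulrC.
Qed.

Lemma is_derive_expRBx (a x : R) : is_derive x (1 : R)%R
  (fun x => expR (a - x))%R (- expR (a - x))%R.
Proof.
have d : is_derive x (1 : R)%R (fun x : R => a - x)%R (- 1)%R.
  apply: is_derive_eq (is_deriveB (is_derive_cst a x 1%R) (is_derive_id x 1%R)) _.
  by rewrite sub0r.
apply: is_derive_eq (is_derive1_comp (is_derive_expR _) d) _.
by rewrite mulrN1.
Qed.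

Lemma is_derive_continuous (f df : R -> R) :
  (forall x : R, is_derive x (1 : R)%R f (df x)) -> continuous f.
Proof.
by move=> d x; apply: differentiable_continuous; apply/derivable1_diffP; have := d x.
Qed.

Lemma integral_half_line (f F : R -> R) (l : R) : (forall x, 0 <= x -> 0 <= f x)%R ->
  continuous f -> (forall x : R, is_derive x (1 : R)%R F (f x)) ->
  F x @[x --> +oo%R] --> l ->
  \int[mu]_(x in `[0%R, +oo[) (f x)%:E = l%:E - (F 0%R)%:E.
Proof.
move=> f0 cf dF Fl; apply: ge0_continuous_FTC2y => //.
- exact: continuous_subspaceT.
- by apply: cvg_at_right_filter; apply: (is_derive_continuous dF).
- by move=> x _; rewrite derive1E; have := dF x => d; rewrite derive_val.
Qed.

(** [(x^2 - 1) * phi x] is the derivative of [- x * phi x], which vanishes at 0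
    and at infinity. *)
Lemma half_line_second_moment :
  \int[mu]_(x in `[0%R, +oo[) (x ^+ 2 * phi x)%:E = \int[mu]_(x in `[0%R, +oo[) (phi x)%:E.
Proof.
set p := normal_peak (1 : R).
have p0 : (0 <= p)%R by exact: normal_peak_ge0.
(* [(x^2 - 1) * phi x] changes sign; adding [k], which dominates [phi] because
   [- x^2 / 2 <= 1 / 2 - x], makes it nonnegative, so that the fundamental
   theorem of calculus applies on the half line *)
pose k (x : R) : R := (p * expR (2^-1 - x))%R.
pose f (x : R) : R := ((x ^+ 2 - 1) * phi x + k x)%R.
have cphi : continuous phi by apply: continuous_normal_pdf; exact: oner_neq0.
have ck : continuous k.
  move=> x; apply: cvgMl_tmp; apply: (is_derive_continuous (is_derive_expRBx _)).
have cx2 : continuous (fun x : R => x ^+ 2)%R by move=> x; exact: exprn_continuous.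
have cf : continuous f.
  have c1 : continuous (fun x : R => (x ^+ 2 - 1) * phi x)%R.
    by apply: continuous_mul_pdf => y; apply: cvgB; [exact: cx2|exact: cvg_cst].
  by move=> x; apply: cvgD; [exact: c1|exact: ck].
have k0 x : (0 <= k x)%R by rewrite mulr_ge0 ?expR_ge0.
have f0 x : (0 <= f x)%R.
  have : (phi x <= k x)%R.
    rewrite normal_pdf01E ler_wpM2l// ler_expR.
    by have := sqr_ge0 (x - 1); lra.
  have := mulr_ge0 (sqr_ge0 x) (normal_pdf_ge0 0 1 x); rewrite /f; lra.
have limk : k x @[x --> +oo%R] --> (0 : R)%R.
  rewrite (_ : k = (fun x => p * expR 2^-1 * expR (- x))%R); last first.
    by apply/funext => x; rewrite /k expRD mulrA.
  by rewrite -[X in _ --> X](mulr0 (p * expR 2^-1)%R); apply: cvgMl_tmp; exact: cvgr_expR.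
have dk (x : R) : is_derive x (1 : R)%R (fun x => - k x)%R (k x).
  rewrite (_ : (fun _ => _) = (- p) \*: (fun x : R => expR (2^-1 - x)))%R; last first.
    by apply/funext => t; rewrite -[RHS]/(- p * expR (2^-1 - t))%R /k mulNr.
  apply: is_derive_eq (is_deriveZ _ (is_derive_expRBx 2^-1 x)) _.
  transitivity (- p * - expR (2^-1 - x))%R; first by [].
  by rewrite mulrNN.
have limNk : (- k x)%R @[x --> +oo%R] --> (0 : R)%R.
  by rewrite -[X in _ --> X]oppr0; apply: cvgN.
have Ik : \int[mu]_(x in `[0%R, +oo[) (k x)%:E = (k 0%R)%:E.
  rewrite (integral_half_line (fun x _ => k0 x) ck dk limNk).
  by rewrite sub0e EFinN oppeK.
(* the primitive of [f] that vanishes at infinity *)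
pose F (x : R) : R := (- p * (x * expR (- (x ^+ 2 / 2))) - k x)%R.
have dF (x : R) : is_derive x (1 : R)%R F (f x).
  rewrite (_ : F = ((- p) \*: ((fun x : R => x) * (fun x : R => expR (- (x ^+ 2 / 2))))
     + (fun x : R => - k x)))%R//.
  apply: is_derive_eq (is_deriveD (is_deriveZ _ (is_deriveM (is_derive_id x 1%R) (is_derive_gauss x)))
    (dk x)) _.
  transitivity (- p * (x * (- x * expR (- (x ^+ 2 / 2))) + expR (- (x ^+ 2 / 2)) * 1) + k x)%R.
    by [].
  rewrite /f normal_pdf01E -/p; ring.
have limF : F x @[x --> +oo%R] --> (0 : R)%R.
  rewrite -[X in _ --> X](subr0 0%R); apply: cvgB; last exact: limk.
  by rewrite -[X in _ --> X](mulr0 (- p)%R); apply: cvgMl_tmp; exact: cvg_mul_gauss.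
have If : \int[mu]_(x in `[0%R, +oo[) (f x)%:E = (k 0%R)%:E.
  rewrite (integral_half_line (fun x _ => f0 x) cf dF limF).
  by rewrite /F mul0r mulr0 sub0r sub0e EFinN oppeK.
have mI (h : R -> R) : continuous h ->
    measurable_fun (`[0%R, +oo[%classic : set R) (fun x => (h x)%:E).
  by move=> ch; apply/measurable_EFinP; apply: measurable_funTS; exact: continuous_measurable_fun.
have phi0 x : (0 <= phi x)%R by exact: normal_pdf_ge0.
(* both sides equal [x^2 * phi x + k x], and the integral of [k] is finite *)
have E : \int[mu]_(x in `[0%R, +oo[) ((f x)%:E + (phi x)%:E)
    = \int[mu]_(x in `[0%R, +oo[) ((x ^+ 2 * phi x)%:E + (k x)%:E).
  by apply: eq_integral => x _; rewrite -!EFinD /f; congr EFin; ring.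
have cx2phi : continuous (fun x : R => x ^+ 2 * phi x)%R by exact: continuous_mul_pdf.
have EL : \int[mu]_(x in `[0%R, +oo[) ((f x)%:E + (phi x)%:E)
    = (k 0%R)%:E + \int[mu]_(x in `[0%R, +oo[) (phi x)%:E.
  rewrite -If; apply: ge0_integralD => //.
  - by move=> x _; rewrite lee_fin.
  - exact: mI.
  - by move=> x _; rewrite lee_fin.
  - exact: mI.
have ER : \int[mu]_(x in `[0%R, +oo[) ((x ^+ 2 * phi x)%:E + (k x)%:E)
    = \int[mu]_(x in `[0%R, +oo[) (x ^+ 2 * phi x)%:E + (k 0%R)%:E.
  rewrite -Ik; apply: ge0_integralD => //.
  - by move=> x _; rewrite lee_fin mulr_ge0 ?sqr_ge0.
  - exact: mI.
  - by move=> x _; rewrite lee_fin.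
  - exact: mI.
have kfin : (k 0%R)%:E \is a fin_num by [].
by rewrite -[LHS](addeK _ kfin) -ER -E EL (addeC (k 0%R)%:E) addeK.
Qed.

Lemma normal_second_moment : \int[N01]_x (x ^+ 2)%:E = 1.
Proof.
have cx2 : continuous (fun x : R => x ^+ 2)%R by move=> x; exact: exprn_continuous.
have cphi : continuous phi by apply: continuous_normal_pdf; exact: oner_neq0.
rewrite ge0_integral_normal; last 2 first.
- by apply/measurable_EFinP; exact: continuous_measurable_fun.
- by move=> x; rewrite lee_fin sqr_ge0.
have hl : [set x : R | (0 <= x)%R] = `[0%R, +oo[%classic by rewrite -set_itvcy.
under eq_integral do rewrite -EFinM.
rewrite (@ge0_symfun_integralT _ (fun x => x ^+ 2 * phi x)%R); last 3 first.
- by move=> x; rewrite mulr_ge0 ?sqr_ge0 ?normal_pdf_ge0.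
- exact: continuous_mul_pdf.
- by move=> x /=; rewrite sqrrN normal_pdf_even.
rewrite hl half_line_second_moment -hl -ge0_symfun_integralT//.
- exact: integral_normal_pdf.
- by move=> x; exact: normal_pdf_ge0.
- by move=> x /=; rewrite normal_pdf_even.
Qed.

End NormalMoments.

(** * Linear combinations of independent normal variables *)

(** The two copies of the Borel sigma-algebra on the line carry different
    displays; the identity transports measures from one to the other. *)
Definition idTR (R : realType) : measurableTypeR R -> R := idfun.

HB.instance Definition _ (R : realType) :=
  @isMeasurableFun.Build _ _ _ _ (@idTR R) (@measurable_id _ _ setT).

Lemma uniq_unzip1_inj (S : eqType) (T : eqType) (s : seq (S * T)) r r' :
  uniq (unzip1 s) -> r \in s -> r' \in s -> r.1 = r'.1 -> r = r'.
Proof.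
elim: s => [//|p s IH] /= /andP[ps us]; rewrite !inE.
move=> /predU1P[->|rs] /predU1P[->|rs']//; last exact: IH.
  by move=> e; move: ps; rewrite e (map_f _ rs').
by move=> e; move: ps; rewrite -e (map_f _ rs).
Qed.

Section StandardNormal.
Context {disp : measure_display} {T : measurableType disp} {R : realType}.
Context (P : probability T R).
Local Open Scope ereal_scope.
Notation N01 := (@normal_prob R 0%R 1%R).

Section OneVariable.
Variable X : {RV P >-> R}.
Hypothesis hX : forall A : set R, measurable A -> distribution P X A = N01 A.

Lemma ge0_expectation_normal (f : R -> R) :
  measurable_fun [set: R] f -> (forall x, 0 <= f x)%R ->
  \int[P]_w (f (X w))%:E = \int[N01]_x (f x)%:E.
Proof.
move=> mf f0.
have mEf : measurable_fun [set: R] (EFin \o f) by exact/measurable_EFinP.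
have f0' (y : R) : 0 <= (EFin \o f) y by rewrite lee_fin.
rewrite -[LHS](ge0_integral_distribution X mEf f0').
rewrite -[RHS](@ge0_integral_distribution _ _ _ _ _ N01 (@idTR R) _ mEf f0').
by apply: eq_measure_integral => A mA _; exact: (hX mA).
Qed.

Lemma integral_normal_sqr : \int[P]_w (X w ^+ 2)%:E = 1.
Proof.
rewrite (@ge0_expectation_normal (fun x => x ^+ 2)%R).
- exact: normal_second_moment.
- exact: exprn_measurable.
- by move=> x; apply: sqr_ge0.
Qed.

Lemma normal_Lfun2 : (X : T -> R) \in Lfun P 2%:E.
Proof.
rewrite inE; apply/andP; split; rewrite inE//=.
rewrite /finite_norm unlock /=; apply: poweR_lty.
apply: (@le_lt_trans _ _ (\int[P]_w (X w ^+ 2)%:E)); last by rewrite integral_normal_sqr ltry.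
rewrite le_eqVlt; apply/orP; left; apply/eqP; apply: eq_integral => w _.
by rewrite /= powR_mulrn// real_normK// num_real.
Qed.

Lemma normal_Lfun1 : (X : T -> R) \in Lfun P 1.
Proof. by apply: Lfun_subset12; [exact: fin_num_measure|exact: normal_Lfun2]. Qed.

Lemma normal_expectation : 'E_P[X] = 0.
Proof.
rewrite unlock integralE.
have mx : measurable_fun [set: R] (fun x : R => Num.max x 0)%R.
  by apply: measurable_maxr.
have mNx : measurable_fun [set: R] (fun x : R => Num.max (- x) 0)%R.
  by apply: measurable_maxr.
have E1 : \int[P]_w (EFin \o X)^\+ w = \int[N01]_x (Num.max x 0)%:E.
  rewrite -(ge0_expectation_normal mx); last by move=> x; rewrite le_max lexx orbT.
  by apply: eq_integral => w _; rewrite funeposE /= -EFin_max.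
have E2 : \int[P]_w (EFin \o X)^\- w = \int[N01]_x (Num.max (- x) 0)%:E.
  rewrite -(ge0_expectation_normal mNx); last by move=> x; rewrite le_max lexx orbT.
  by apply: eq_integral => w _; rewrite funenegE /= -EFin_max.
have iX : P.-integrable setT (EFin \o X) by apply/Lfun1_integrable; exact: normal_Lfun1.
have fin : \int[P]_w (EFin \o X)^\+ w \is a fin_num.
  by apply: integrable_fin_num => //; exact: integrable_funepos.
by rewrite E2 -normal_mean_parts -E1 subee.
Qed.

Lemma normal_variance : covariance P X X = 1.
Proof.
rewrite covarianceE ?normal_Lfun1// ?Lfun2_mul_Lfun1 ?normal_Lfun2//.
rewrite normal_expectation mule0 sube0 unlock -integral_normal_sqr.
by apply: eq_integral => w _; rewrite expr2.
Qed.

End OneVariable.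

(** The law of an independent pair is the product of the laws, by uniqueness of
    the product measure on rectangles; Fubini's theorem concludes. *)
Lemma independent_expectationM (X Y : {RV P >-> R}) :
  (X : T -> R) \in Lfun P 2%:E -> (Y : T -> R) \in Lfun P 2%:E ->
  (forall A B : set R, measurable A -> measurable B ->
    P (X @^-1` A `&` Y @^-1` B) = P (X @^-1` A) * P (Y @^-1` B)) ->
  'E_P[(X \* Y)%R] = 'E_P[X] * 'E_P[Y].
Proof.
move=> X2 Y2 ind.
have X1 : P.-integrable setT (EFin \o X).
  by apply/Lfun1_integrable; apply: Lfun_subset12; rewrite ?fin_num_measure.
have Y1 : P.-integrable setT (EFin \o Y).
  by apply/Lfun1_integrable; apply: Lfun_subset12; rewrite ?fin_num_measure.
have XY1 : P.-integrable setT (EFin \o (X \* Y)%R).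
  by apply/Lfun1_integrable; exact: Lfun2_mul_Lfun1.
pose XY w := (X w, Y w).
have mXY : measurable_fun [set: T] XY by exact: measurable_fun_pair.
pose f (z : R * R) : \bar R := (z.1 * z.2)%:E.
have mf : measurable_fun [set: R * R] f.
  by apply/measurable_EFinP; apply: measurable_funM; [exact: measurable_fst|exact: measurable_snd].
pose m1 : probability _ R := distribution P X; pose m2 : probability _ R := distribution P Y.
have joint (A : set (R * R)) : measurable A -> (m1 \x m2) A = pushforward P XY A.
  by move=> mA; apply: product_measure_unique.
have If : (m1 \x m2).-integrable setT f.
  apply/integrableP; split=> //.
  rewrite (eq_measure_integral (pushforward P XY)) => [|A mA _]; last exact: joint.
  rewrite ge0_integral_pushforward//; last exact: measurableT_comp.
  by have /integrableP[] := XY1.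
have EXY : \int[P]_w (X w * Y w)%:E = \int[m1 \x m2]_z f z.
  rewrite (eq_measure_integral (pushforward P XY)) => [|A mA _]; last exact: joint.
  by rewrite integral_pushforward.
rewrite unlock /= EXY -(integral12_prod_meas1 If) /=.
have EX : \int[m1]_x x%:E = 'E_P[X].
  by rewrite unlock integral_distribution//; exact: measurable_EFin.
have EY : \int[m2]_y y%:E = 'E_P[Y].
  by rewrite unlock integral_distribution//; exact: measurable_EFin.
have i1 : m1.-integrable setT EFin.
  by apply: integrable_pushforward => //; exact: measurable_EFin.
have i2 : m2.-integrable setT EFin.
  by apply: integrable_pushforward => //; exact: measurable_EFin.
have Yfin : 'E_P[Y] \is a fin_num.
  by rewrite unlock; apply: integrable_fin_num.
transitivity (\int[m1]_x (x%:E * 'E_P[Y])).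
  apply: eq_integral => x _; rewrite /fubini_F /f /=.
  under eq_integral do rewrite EFinM.
  by rewrite integralZl// EY.
have <- : 'E_P[X] = \int[P]_w (X w)%:E by rewrite unlock.
have <- : 'E_P[Y] = \int[P]_w (Y w)%:E by rewrite unlock.
by rewrite -(fineK Yfin) integralZr// EX.
Qed.

Section Family.
Variables (I : eqType) (Z : I -> {RV P >-> R}).
Hypothesis indZ : mutually_independent Z.
Hypothesis normZ : forall a (A : set R), measurable A -> distribution P (Z a) A = N01 A.

(** Off the diagonal this is independence, on the diagonal the second moment. *)
Lemma normal_family_covariance a b : covariance P (Z a) (Z b) = (a == b)%:R%:E.
Proof.
have [->|ab] := eqVneq a b; first by rewrite normal_variance// => A; exact: normZ.
have L2 i := normal_Lfun2 (normZ i); have L1 i := normal_Lfun1 (normZ i).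
rewrite covarianceE ?L1// ?Lfun2_mul_Lfun1 ?L2//.
rewrite (independent_expectationM (L2 a) (L2 b)).
  by rewrite !(normal_expectation (normZ _)) mule0 subee.
move=> A B mA mB; pose C i := if i == a then A else B.
have u : uniq [:: a; b] by rewrite /= inE ab.
have mC i : measurable (C i) by rewrite /C; case: ifP.
have := indZ u mC; rewrite big_cons big_seq1 /C eqxx eq_sym (negbTE ab) => <-.
congr (P _); apply/seteqP; split => w /=.
  by move=> [wA wB] i /=; rewrite !inE => /orP[] /eqP ->; rewrite ?eqxx// eq_sym (negbTE ab).
move=> h; split.
  by have := h a; rewrite /= eqxx; apply; rewrite mem_head.
by have := h b; rewrite /= eq_sym (negbTE ab); apply; rewrite !inE eqxx orbT.
Qed.

Definition lincomb (c : R) (s : seq (I * R)) (w : T) : R :=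
  (c + \sum_(p <- s) p.2 * Z p.1 w)%R.

Lemma lincomb_Lfun2 c s : lincomb c s \in Lfun P 2%:E.
Proof.
elim: s => [|p s IH].
  rewrite (_ : lincomb c [::] = cst c) ?Lfun_cst//.
  by apply/funext => w; rewrite /lincomb big_nil addr0.
rewrite (_ : lincomb c (p :: s) = (p.2 \o* Z p.1 \+ lincomb c s)%R).
  by rewrite rpredD//= ?lee1n// Lfun_scale// ?ler1n// (normal_Lfun2 (normZ _)).
by apply/funext => w; rewrite /lincomb big_cons /= addrCA [(Z _ _ * _)%R]mulrC.
Qed.

Lemma covariance_lincomb_var c s b :
  covariance P (lincomb c s) (Z b) = (\sum_(p <- s | p.1 == b) p.2)%R%:E.
Proof.
elim: s => [|p s IH].
  rewrite (_ : lincomb c [::] = cst c) ?covariance_cst_l ?big_nil//.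
  by apply/funext => w; rewrite /lincomb big_nil addr0.
rewrite (_ : lincomb c (p :: s) = (p.2 \o* Z p.1 \+ lincomb c s)%R); last first.
  by apply/funext => w; rewrite /lincomb big_cons /= addrCA [(Z _ _ * _)%R]mulrC.
have L2 i := normal_Lfun2 (normZ i); have L1 i := normal_Lfun1 (normZ i).
rewrite covarianceDl ?lincomb_Lfun2 ?L2 ?Lfun_scale ?ler1n//.
rewrite covarianceZl ?L1 ?Lfun2_mul_Lfun1 ?L2// normal_family_covariance IH big_cons.
by case: eqP => _; rewrite ?mule1 ?mule0 ?add0e.
Qed.

Lemma covariance_lincomb c s c' t : covariance P (lincomb c s) (lincomb c' t)
  = (\sum_(p <- t) p.2 * (\sum_(r <- s | r.1 == p.1) r.2))%R%:E.
Proof.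
elim: t => [|p t IH].
  rewrite (_ : lincomb c' [::] = cst c') ?covariance_cst_r ?big_nil//.
  by apply/funext => w; rewrite /lincomb big_nil addr0.
rewrite (_ : lincomb c' (p :: t) = (p.2 \o* Z p.1 \+ lincomb c' t)%R); last first.
  by apply/funext => w; rewrite /lincomb big_cons /= addrCA [(Z _ _ * _)%R]mulrC.
have L2 i := normal_Lfun2 (normZ i); have L1 i := normal_Lfun1 (normZ i).
have l2 := lincomb_Lfun2 c s.
have l1 : lincomb c s \in Lfun P 1.
  by apply: Lfun_subset12; rewrite ?fin_num_measure.
rewrite covarianceDr ?lincomb_Lfun2 ?L2 ?Lfun_scale ?ler1n//.
by rewrite covarianceZr ?L1 ?l1 ?Lfun2_mul_Lfun1 ?L2// covariance_lincomb_var IH big_cons.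
Qed.

(** In the double sum for an entry only the diagonal terms survive, because the
    variables are distinct members of an uncorrelated family. *)
Lemma covariance_mx_expansion (p : nat) (V : T -> 'cV[R]_p) (z : 'cV[R]_p)
    (s : seq (I * 'cV[R]_p)) : uniq (unzip1 s) ->
  (forall w, V w = z + \sum_(r <- s) Z r.1 w *: r.2)%R ->
  covariance_mx P V = (\sum_(r <- s) r.2 *m r.2^T)%R.
Proof.
move=> us VE; apply/matrixP => i j; rewrite mxE summxE.
pose s' (i : 'I_p) := [seq ((r : I * 'cV[R]_p).1, r.2 i 0%R) | r <- s].
have VE' k : (fun w => V w k 0%R) = lincomb (z k 0%R) (s' k).
  apply/funext => w; rewrite VE /lincomb /s' big_map !mxE summxE; congr +%R.
  by apply: eq_bigr => r _; rewrite mxE mulrC.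
rewrite !VE' covariance_lincomb /= /s' big_map.
rewrite big_seq [RHS]big_seq; apply: eq_bigr => r rs.
rewrite mxE big_ord1 !mxE big_map /= mulrC; congr *%R.
rewrite big_mkcond (bigD1_seq r)/= ?eqxx ?(map_uniq us)//.
rewrite big_seq_cond big1 ?addr0// => r' /andP[r's nr].
by case: eqP => // e; rewrite (uniq_unzip1_inj us r's rs e) eqxx in nr.
Qed.

End Family.

End StandardNormal.

(** * Covariance of the scheme *)

Section ProcessCovariance.
Context {disp : measure_display} {T : measurableType disp} {R : realType}.
Context (P : probability T R) (d : nat) (ds gamma dt : R).
Variables (xi eta : nat -> 'I_d -> {RV P >-> R}) (z0 : 'cV[R]_(d + d)).
Hypotheses (ds_gt0 : 0 < ds) (gamma_gt0 : 0 < gamma) (dt_gt0 : 0 < dt).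

Local Notation noise_index := ((nat * 'I_d) + (nat * 'I_d))%type.
Local Notation OC := (Omx d gamma dt *m Cmx d ds dt).
Local Notation M := (Omx d gamma dt *m Cmx d ds dt *m Omx d gamma dt).
Local Notation sigma := (Num.sqrt (1 / ds) * Num.sqrt (1 - expR (- (gamma * dt)))).

Definition noise_var (a : noise_index) : {RV P >-> R} :=
  match a with inl ki => xi ki.1 ki.2 | inr ki => eta ki.1 ki.2 end.

Definition noise_time (a : noise_index) : nat :=
  match a with inl ki => ki.1 | inr ki => ki.1 end.

Definition momentum_inj : 'M[R]_(d + d, d) := col_mx 0 1%:M.

Lemma col_delta_sum (x : 'cV[R]_d) : x = \sum_i x i 0 *: delta_mx i 0.
Proof.
rewrite {1}[x]matrix_sum_delta; apply: eq_bigr => i _.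
by rewrite big_ord1.
Qed.

Lemma momentum_inj_gram : momentum_inj *m momentum_inj^T = Pmx d.
Proof.
rewrite /momentum_inj tr_col_mx mul_col_row !trmx0 trmx1 !mulmx0 !mul0mx.
by rewrite mulmx1.
Qed.

Lemma delta_gram : \sum_(i < d) delta_mx i 0 *m (delta_mx i 0 : 'cV[R]_d)^T = 1%:M.
Proof.
by rewrite mx1_sum_delta; apply: eq_bigr => i _; rewrite trmx_delta mul_delta_mx.
Qed.

(** Turns the half step into an affine map of its noise vector. *)
Lemma ou_half_stepE (z : 'cV[R]_(d + d)) (x : 'cV[R]_d) :
  ou_half_step ds gamma dt z x = Omx d gamma dt *m z + sigma *: (momentum_inj *m x).
Proof.
rewrite -{2}[z]vsubmxK /Omx mul_block_col /momentum_inj mul_col_mx scale_col_mx add_col_mx.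
by rewrite !mul0mx !mul1mx scaler0 !addr0 add0r mul_scalar_mx.
Qed.

Lemma sigma_sqr : sigma ^+ 2 = ds^-1 * (1 - damp gamma dt ^+ 2).
Proof.
rewrite exprMn !sqr_sqrtr ?div1r ?invr_ge0 ?(ltW ds_gt0)//; last first.
  by rewrite subr_ge0 -[leRHS]expR0 ler_expR oppr_le0 mulr_ge0// ltW.
congr (_ * (1 - _)); rewrite /damp -expRM_natl mulrN; congr (expR (- _)).
by rewrite [RHS]mulrC divfK ?pnatr_eq0.
Qed.

Lemma affine_step (O C : 'M[R]_(d + d)) (J : 'M[R]_(d + d, d)) (a : R) z (x y : 'cV[R]_d) :
  O *m (C *m (O *m z + a *: (J *m x))) + a *: (J *m y)
  = O *m C *m O *m z + (\sum_i x i 0 *: (a *: (O *m C *m J) *m delta_mx i 0)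
     + \sum_i y i 0 *: (a *: J *m delta_mx i 0)).
Proof.
have lin (K : 'M[R]_(d + d, d)) (v : 'cV[R]_d) :
    a *: (K *m v) = \sum_i v i 0 *: (a *: K *m delta_mx i 0).
  rewrite {1}[v]col_delta_sum mulmx_sumr scaler_sumr; apply: eq_bigr => i _.
  by rewrite -scalemxAr -scalemxAl !scalerA mulrC.
by rewrite -!lin !mulmxDr -!scalemxAr !mulmxA addrA.
Qed.

(** One step multiplies the old coefficient vectors by [M] and appends those of
    the noise of the current step; the bound on [noise_time] shows that the
    appended variables are new.  The Gram matrix of the coefficients
    therefore follows the recursion [X |-> M X M^T + noise_cov], of which [H]
    is a fixed point. *)
Lemma process_expansion m : exists z s,
  [/\ uniq (unzip1 s), all (fun r : noise_index * 'cV[R]_(d + d) => noise_time r.1 < m)%N s,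
    forall w, cayley_process ds gamma dt z0 xi eta m w
      = z + \sum_(r <- s) noise_var r.1 w *: r.2 &
    forall H, M *m H *m M^T + noise_cov d ds gamma dt = H ->
      \sum_(r <- s) r.2 *m r.2^T = H - M ^+ m *m H *m (M ^+ m)^T].
Proof.
elim: m => [|m [z [s [us ts VE SE]]]].
  exists z0, [::]; split=> //.
    by move=> w; rewrite big_nil addr0.
  by move=> H _; rewrite big_nil expr0 trmx1 mul1mx mulmx1 subrr.
pose A : 'M[R]_(d + d, d) := sigma *: (OC *m momentum_inj).
pose B : 'M[R]_(d + d, d) := sigma *: momentum_inj.
pose sM := [seq ((r : noise_index * 'cV[R]_(d + d)).1, M *m r.2) | r <- s].
pose sA : seq (noise_index * 'cV[R]_(d + d)) := [seq ((inl (m, i) : noise_index), A *m delta_mx i 0) | i <- index_enum 'I_d].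
pose sB : seq (noise_index * 'cV[R]_(d + d)) := [seq ((inr (m, i) : noise_index), B *m delta_mx i 0) | i <- index_enum 'I_d].
have uM : unzip1 sM = unzip1 s by rewrite /unzip1 /sM -map_comp.
exists (M *m z), (sM ++ sA ++ sB); split.
- rewrite /unzip1 !map_cat -!/(unzip1 _) uM !cat_uniq us /=.
  have tA a : a \in unzip1 sA -> exists i, a = inl (m, i).
    by rewrite /unzip1 -map_comp => /mapP[i _ ->]; exists i.
  have tB a : a \in unzip1 sB -> exists i, a = inr (m, i).
    by rewrite /unzip1 -map_comp => /mapP[i _ ->]; exists i.
  have ns a : a \in unzip1 s -> (noise_time a < m)%N.
    by move=> /mapP[r rs ->]; apply: (allP ts).
  apply/and4P; split.
  + apply/hasPn => a; rewrite mem_cat => /orP[/tA|/tB] [i ->]; apply/negP => /ns;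
      by rewrite /= ltnn.
  + by rewrite /unzip1 -map_comp map_inj_uniq ?index_enum_uniq// => i j [].
  + by apply/hasPn => a /tB[i ->]; apply/negP => /tA[].
  + by rewrite /unzip1 -map_comp map_inj_uniq ?index_enum_uniq// => i j [].
- rewrite !all_cat; apply/and3P; split.
  + rewrite all_map; apply: sub_all ts => r /= h; exact: ltnW.
  + by rewrite all_map; apply/allP => i _ /=.
  + by rewrite all_map; apply/allP => i _ /=.
- move=> w; rewrite /cayley_process /= /cayley_step !ou_half_stepE affine_step.
  rewrite -/(cayley_process _ _ _ _ _ _ _ w) VE !big_cat !big_map /=.
  rewrite mulmxDr mulmx_sumr -!addrA; congr (_ + (_ + (_ + _))).
  + by apply: eq_bigr => r _; rewrite -scalemxAr.
  + by apply: eq_bigr => i _; rewrite mxE.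
  + by apply: eq_bigr => i _; rewrite mxE.
- move=> H HE; rewrite !big_cat !big_map /=.
  have gram (K : 'M[R]_(d + d, d)) :
      \sum_(i < d) K *m delta_mx i 0 *m (K *m (delta_mx i 0 : 'cV[R]_d))^T = K *m K^T.
    rewrite -[X in X *m K^T]mulmx1 -delta_gram mulmx_sumr mulmx_suml.
    by apply: eq_bigr => i _; rewrite trmx_mul !mulmxA.
  rewrite !gram /A /B.
  have -> : \sum_(r <- s) M *m r.2 *m (M *m r.2)^T = M *m (\sum_(r <- s) r.2 *m r.2^T) *m M^T.
    rewrite mulmx_sumr mulmx_suml; apply: eq_bigr => r _.
    by rewrite [(M *m r.2)^T]trmx_mul !mulmxA.
  rewrite (SE H HE).
  have gs (K : 'M[R]_(d + d, d)) : (sigma *: K) *m (sigma *: K)^T = sigma ^+ 2 *: (K *m K^T).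
    have -> : (sigma *: K)^T = sigma *: K^T by apply/matrixP => i j; rewrite !mxE.
    by rewrite -scalemxAr -scalemxAl scalerA.
  rewrite !gs sigma_sqr -scalerDr momentum_inj_gram.
  have -> : OC *m momentum_inj *m (OC *m momentum_inj)^T = OC *m Pmx d *m OC^T.
    by rewrite [(OC *m momentum_inj)^T]trmx_mul mulmxA -(mulmxA OC) momentum_inj_gram.
  rewrite -/(noise_cov d ds gamma dt) -[X in _ = X - _]HE.
  have -> : M ^+ m.+1 *m H *m (M ^+ m.+1)^T = M *m (M ^+ m *m H *m (M ^+ m)^T) *m M^T.
    by rewrite exprS -[M * _]/(M *m M ^+ m) [(M *m _)^T]trmx_mul !mulmxA.
  move: M (M ^+ m) (noise_cov d ds gamma dt) => M' Mm Q.
  by rewrite mulmxBr mulmxBl addrAC.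
Qed.

End ProcessCovariance.

Section CovarianceOfProcess.
Context {disp : measure_display} {T : measurableType disp} {R : realType}.

Lemma process_covariance (P : probability T R) (d : nat) (ds gamma dt : R)
    (xi eta : nat -> 'I_d -> {RV P >-> R}) (z0 : 'cV[R]_(d + d)) m (H : 'M[R]_(d + d)) :
  0 < ds -> 0 < gamma -> 0 < dt -> standard_normal_noise xi eta ->
  let M := Omx d gamma dt *m Cmx d ds dt *m Omx d gamma dt in
  M *m H *m M^T + noise_cov d ds gamma dt = H ->
  covariance_mx P (cayley_process ds gamma dt z0 xi eta m)
  = H - M ^+ m *m H *m (M ^+ m)^T.
Proof.
move=> ds0 g0 dt0 [ind nrm] M HE.
have [z [s [us _ VE SE]]] := process_expansion xi eta z0 ds0 g0 dt0 m.
by rewrite (covariance_mx_expansion ind nrm us VE) (SE H HE).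
Qed.

End CovarianceOfProcess.

(** * The error bounds *)

(** [n.-1 <= n = S / ds] counts the modes and [m * dt <= T] the steps; the
    exponent [a] is the power of the bound on the squared frequency that one mode
    contributes.  The summand 1 keeps the constant positive when [C = 0]. *)
Lemma summed_error_le (R : realType) (S C T dt : R) (n a : nat) :
  0 < S -> 0 <= C -> 0 < T -> 0 < dt -> (2 <= n)%N ->
  let ds := S / n%:R in
  n.-1%:R * ((Num.truncn (T / dt))%:R * (C * dt ^+ 3 * (1 + 4 / ds ^+ 2) ^+ a))
  <= expR ((S * C * (S ^+ 2 + 4) ^+ a + 1) * T) * dt ^+ 2 * ds ^- (2 * a + 1).
Proof.
move=> S0 C0 T0 dt0 n2; cbv zeta; set ds := S / _; set m := Num.truncn _; set B := 1 + _.
have n0 : 0 < n%:R :> R by rewrite ltr0n (ltn_trans _ n2).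
have ds0 : 0 < ds by rewrite divr_gt0.
have i0 : 0 < ds^-1 by rewrite invr_gt0.
have dsn : S * ds^-1 = n%:R by rewrite /ds invf_div mulrC divfK// gt_eqF.
have mT : m%:R * dt <= T by rewrite -ler_pdivlMr// truncn_le divr_ge0 ?ltW.
have dn : n.-1%:R <= S * ds^-1 by rewrite dsn ler_nat leq_pred.
have n1 : 1 <= S * ds^-1 by rewrite dsn ler1n (ltn_trans _ n2).
have B0 : 0 <= B by rewrite addr_ge0// divr_ge0// sqr_ge0.
have BE : B <= (S ^+ 2 + 4) * ds ^- 2.
  by rewrite mulrDl lerD2r -exprVn -exprMn expr_ge1// (le_trans ler01).
have hB : B ^+ a <= ((S ^+ 2 + 4) * ds ^- 2) ^+ a by rewrite lerXn2r ?nnegrE// (le_trans B0).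
have -> : n.-1%:R * (m%:R * (C * dt ^+ 3 * B ^+ a)) = (n.-1%:R * (m%:R * dt)) * (C * dt ^+ 2 * B ^+ a) by ring.
apply: (@le_trans _ _ ((S * ds^-1 * T) * (C * dt ^+ 2 * ((S ^+ 2 + 4) * ds ^- 2) ^+ a))).
  apply: ler_pM; rewrite ?mulr_ge0 ?exprn_ge0 ?(ltW dt0)//.
    by apply: ler_pM; rewrite ?mulr_ge0 ?(ltW dt0).
  by rewrite ler_wpM2l// mulr_ge0 ?exprn_ge0 ?(ltW dt0).
have -> : (S * ds^-1 * T) * (C * dt ^+ 2 * ((S ^+ 2 + 4) * ds ^- 2) ^+ a)
    = (S * C * (S ^+ 2 + 4) ^+ a * T) * dt ^+ 2 * ds ^- (2 * a + 1).
  by rewrite exprMn -!exprVn exprD exprM expr1; ring.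
rewrite ler_wpM2r ?invr_ge0 ?exprn_ge0 ?(ltW ds0)// ler_wpM2r ?exprn_ge0 ?(ltW dt0)//.
set K := S * C * _; apply: le_trans (expR_ge1Dx _).
by rewrite mulrDl mul1r; lra.
Qed.

Unset Implicit Arguments.
Set Strict Implicit.

Theorem proposition3p20 (R : realType) (S gamma : R)
    (S_gt0 : 0 < S) (gamma_gt0 : 0 < gamma) :
  exists C1 C2 : R, 0 < C1 /\ 0 < C2 /\
  forall (T : R) (n : nat) (dt : R), 0 < T -> (2 <= n)%N ->
  0 < dt -> dt < 2 ->
  let d := n.-1 in
  let ds := S / n%:R in
  let m := Num.truncn (T / dt) in
  0 < g dt (2 / ds) gamma ->
  frobenius ((Omx d gamma dt *m Cmx d ds dt *m Omx d gamma dt) ^+ m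
             - Phi d ds gamma (m%:R * dt))
    <= expR (C1 * T) * dt ^+ 2 * ds ^- 5 /\
  (forall (disp : measure_display) (Omega : measurableType disp)
          (P : probability Omega R)
          (xi eta : nat -> 'I_d -> {RV P >-> R})
          (z0 : 'cV[R]_(d + d)) (Gamma : 'M[R]_(d + d)),
     standard_normal_noise xi eta ->
     is_exact_covariance ds gamma (m%:R * dt) Gamma ->
     frobenius (covariance_mx P (cayley_process ds gamma dt z0 xi eta m)
                - Gamma)
       <= expR (C2 * T) * dt ^+ 2 * ds ^- 4).
Proof.
pose q0 := (1 - (cosh (gamma / 2))^-1) / 2.
have q0_gt0 : 0 < q0.
  have k1 : 1 < cosh (gamma / 2) by apply: cosh_gt1; rewrite divr_gt0.
  by rewrite divr_gt0// subr_gt0 invf_lt1// (lt_trans ltr01).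
have [C C0 hC] := propagator_error gamma_gt0 q0_gt0.
have [C' C'0 hC'] := covariance_error gamma_gt0 q0_gt0.
exists (S * C * (S ^+ 2 + 4) ^+ 2 + 1), (S * C' * (S ^+ 2 + 4) ^+ 1 + 1).
have pos (c : R) a : 0 <= c -> 0 < S * c * (S ^+ 2 + 4) ^+ a + 1.
  move=> c0; apply: ltr_wpDl => //; rewrite !mulr_ge0 ?(ltW S_gt0)// exprn_ge0//.
  by rewrite addr_ge0 ?sqr_ge0.
split; first exact: pos.
split; first exact: pos.
move=> T n dt T0 n2 dt0 dt2 d ds m hg.
have ds0 : 0 < ds by rewrite divr_gt0// ltr0n (ltn_trans _ n2).
have hq : q0 <= defect dt := defect_ge gamma_gt0 dt0 dt2 hg.
split.
  by apply: le_trans (hC _ _ _ _ ds0 dt0 dt2 hq) _; exact: summed_error_le.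
move=> disp Omega P xi eta z0 Gamma noise exact.
have [H HE] := hC' _ _ _ _ _ ds0 dt0 dt2 hq exact.
rewrite (process_covariance z0 m ds0 gamma_gt0 dt0 noise HE) => /le_trans; apply.
(* the noise has size [ds^-1], which accounts for the factor in front *)
have := @summed_error_le _ _ _ _ _ _ 1 S_gt0 C'0 T0 dt0 n2; rewrite -/ds => h.
rewrite -(expr1 (1 + _)); move: h; rewrite /= -(ler_pM2l (x := ds^-1)) ?invr_gt0// => /le_trans; apply.
by rewrite -!exprVn mulrCA -exprS.
Qed.
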